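(* Let $G$ be a finitely generated infinite group and let $1<p\in\mathbb{R}$. Then $\#(\partial_p(G))>1$ if and only if there exists a nonzero continuous translation invariant linear functional on $D_p(G)/\mathbb{C}$, where $\partial_p(G)$ is the $p$-harmonic boundary of $G$.
   Context: Let $G$ be a finitely generated group with identity $e_G$ and finite symmetric generating set $S$. $D_p(G)$ is the set of functions $f:G\to\mathbb{C}$ with $\sum_{g\in G}|f(gs^{-1})-f(g)|^p<\infty$ for all $s\in S$, with pseudonorm $\|f\|=\left(\sum_{s\in S}\sum_{g\in G}|f(gs^{-1})-f(g)|^p\right)^{1/p}$ and Banach norm $\|f\|_{D_p}=(\|f\|^p+|f(e_G)|^p)^{1/p}$. For $A\subseteq D_p(G)$, $(\overline{A})_{D_p}$ is the closure of $A$ in $D_p(G)$. $\mathbb{C}$ is identified with the constant functions; $D_p(G)/\mathbb{C}$ is a Banach space under the norm $\|[f]\|_{D(p)}=\|f\|$. The right translation of $f$ by $x\in G$ is $f_x(g)=f(gx^{-1})$; it induces a translation on $D_p(G)/\mathbb{C}$ by $[f]_x=[f_x]$. A translation invariant linear functional (TILF) on a translation invariant space $E$ is a linear functional $T$ on $E$ with $T(f_x)=T(f)$ for all $f\in E$, $x\in G$. $\mathbb{C}G$ is the set of finitely supported functions on $G$. $BD_p(G)$ is the set of bounded functions in $D_p(G)$; it is a commutative Banach algebra under pointwise operations with norm $\|f\|_{BD_p}=\|f\|_\infty+\|f\|$. $Sp(BD_p(G))$ is the set of characters (nonzero algebra homomorphisms $BD_p(G)\to\mathbb{C}$), with the weak-$*$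 topology. For $f\in BD_p(G)$, $\hat f(\tau)=\tau(f)$. $G$ is identified with its image under the injection $i:G\to Sp(BD_p(G))$, $(i(g))(f)=f(g)$. $B(\overline{\mathbb{C}G})_{D_p}$ is the set of bounded functions in $(\overline{\mathbb{C}G})_{D_p}$. The $p$-harmonic boundary is $\partial_p(G)=\{x\in Sp(BD_p(G))\setminus G : \hat f(x)=0 \text{ for all } f\in B(\overline{\mathbb{C}G})_{D_p}\}$. $\#(A)$ denotes the cardinality of $A$. *)

(* Defs.v *)
From HB Require Import structures.
From mathcomp Require Import all_boot all_order all_algebra finmap.
From mathcomp Require Import complex ring lra.
From mathcomp Require Import all_classical all_reals all_analysis.

Set Implicit Arguments.
Unset Strict Implicit.
Unset Printing Implicit Defensive.

Import Order.TTheory GRing.Theory Num.Theory.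
Import numFieldNormedType.Exports.
Import ComplexField.Normc.

Local Open Scope classical_set_scope.
Local Open Scope ring_scope.
Local Open Scope complex_scope.

Definition is_subgroup (G : groupType) (H : set G) : Prop :=
  [/\ H 1%g, forall x y, H x -> H y -> H (x * y)%g & forall x, H x -> H x^-1%g].

(* A finite symmetric generating set of G: the last field says that the only
   subgroup of G containing it is G itself. *)
Record generating_set (G : groupType) := GeneratingSet {
  generators :> {fset G};
  generatorsV : forall s, s \in generators -> (s^-1)%g \in generators;
  generatorsT : forall H : set G, is_subgroup H ->
    (forall s, s \in generators -> H s) -> H = [set: G]
}.

(* The p-th power sum of u over G: \esum is the unordered sum of nonnegative
   terms, valued in \bar R. *)
Section lpsum.
Context {R : realType} {G : choiceType}.
Implicit Types (p : R) (u v : G -> R[i]) (c : R[i]).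

Definition lpsum p u : \bar R := (\esum_(g in [set: G]) (normc (u g) `^ p)%:E)%E.

Lemma normc_ge0 c : 0 <= normc c.
Proof. by case: c => a b; exact: sqrtr_ge0. Qed.

Lemma normcE c : `|c| = (normc c)%:C.
Proof. by []. Qed.

Lemma normcD c d : normc (c + d) <= normc c + normc d.
Proof. by rewrite -lecR rmorphD /= -!normcE ler_normD. Qed.

Lemma normc_real (t : R) : normc t%:C = `|t|.
Proof. by rewrite /= expr0n addr0 sqrtr_sqr. Qed.

Lemma lpsum_ge0 p u : (0 <= lpsum p u)%E.
Proof. by apply: esum_ge0 => g _; rewrite lee_fin powR_ge0. Qed.

Lemma esumZ (t : R) (a : G -> \bar R) : 0 <= t -> (forall g, (0 <= a g)%E) ->
  (\esum_(g in [set: G]) (t%:E * a g) = t%:E * \esum_(g in [set: G]) a g)%E.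
Proof.
move=> t0 a0; rewrite /esum -ereal_supZl//; last first.
  apply/set0P; exists (\sum_(x \in set0) a x)%E; exists set0 => //.
congr ereal_sup; apply/seteqP; split => [_ [A fA <-]|_ [_ [A fA <-] <-]] /=.
  exists (\sum_(x \in A) a x)%E; first by exists A.
  by rewrite ge0_mule_fsumr.
by exists A => //; rewrite ge0_mule_fsumr.
Qed.

Lemma lpsumZ p c u : lpsum p (c *: u) = ((normc c `^ p)%:E * lpsum p u)%E.
Proof.
rewrite /lpsum -esumZ ?powR_ge0//; last by move=> g; rewrite lee_fin powR_ge0.
by apply: eq_esum => g _; rewrite -EFinM -powRM ?normc_ge0// -normcM.
Qed.

Lemma powR_conv p (t a b : R) : 1 < p -> 0 <= t <= 1 -> 0 <= a -> 0 <= b ->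
  (t * a + (1 - t) * b) `^ p <= t * a `^ p + (1 - t) * b `^ p.
Proof.
move=> p1 /andP[t0 t1] a0 b0.
have := @convex_powR R p (ltW p1) (Itv01 t0 t1) a b.
by rewrite !inE/= !in_itv/= a0 b0 => /(_ erefl erefl).
Qed.

Lemma normc_conv p (t : R) (a b : R[i]) : 1 < p -> 0 <= t <= 1 ->
  normc (t%:C * a + (1 - t)%:C * b) `^ p <=
  t * normc a `^ p + (1 - t) * normc b `^ p.
Proof.
move=> p1 t01; have /andP[t0 t1] := t01.
apply: le_trans (powR_conv p1 t01 (normc_ge0 a) (normc_ge0 b)).
apply: ge0_ler_powR; rewrite ?nnegrE ?normc_ge0//.
- by rewrite ltW// (lt_trans ltr01).
- by rewrite addr_ge0// mulr_ge0 ?normc_ge0// subr_ge0.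
- apply: le_trans (normcD _ _) _.
  by rewrite !normcM !normc_real !ger0_norm// subr_ge0.
Qed.

Lemma lpsum_conv p (t : R) u v : 1 < p -> 0 <= t <= 1 ->
  (lpsum p (t%:C *: u + (1 - t)%:C *: v)%R <=
   t%:E * lpsum p u + (1 - t)%:E * lpsum p v)%E.
Proof.
move=> p1 t01; have /andP[t0 t1] := t01.
rewrite /lpsum -!esumZ ?subr_ge0//;
  try by move=> g; rewrite lee_fin powR_ge0.
rewrite -esumD; last 2 first.
- by move=> g _; rewrite lee_fin mulr_ge0// powR_ge0.
- by move=> g _; rewrite lee_fin mulr_ge0 ?subr_ge0// powR_ge0.
by apply: le_esum => g _; rewrite lee_fin; exact: normc_conv.
Qed.

Lemma lpsum_finZ p c u : (lpsum p u < +oo -> lpsum p (c *: u) < +oo)%E.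
Proof.
move=> ufin; rewrite lpsumZ lte_mul_pinfty ?lee_fin ?powR_ge0//.
Qed.

Lemma lpsum_finD p u v : 1 < p ->
  (lpsum p u < +oo -> lpsum p v < +oo -> lpsum p (u + v)%R < +oo)%E.
Proof.
move=> p1 ufin vfin.
have h : 0 <= (2^-1 : R) <= 1 by apply/andP; split; lra.
have -> : u + v = (2^-1 : R)%:C *: (2 *: u) + (1 - 2^-1 : R)%:C *: (2 *: v).
  have -> : (1 - 2^-1 : R)%:C = 2^-1 by rewrite rmorphB fmorphV /= rmorph1 rmorph_nat; field.
  by rewrite fmorphV rmorph_nat !scalerA mulVf ?scale1r ?pnatr_eq0.
apply: le_lt_trans (lpsum_conv _ _ p1 h) _.
have h1 : 0 <= 1 - 2^-1 :> R by lra.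
have h2 : 0 <= 2^-1 :> R by lra.
by apply: lte_add_pinfty; apply: lte_mul_pinfty; rewrite ?lee_fin// lpsum_finZ.
Qed.

End lpsum.

(* Minkowski's inequality, in the form: the p-th root of a convex function
   that is absolutely homogeneous of degree p is subadditive. *)
Lemma root_triangle (R : realType) (V : lmodType R[i]) (p : R) (Phi : V -> R) :
    1 < p -> (forall f, 0 <= Phi f) ->
    (forall c f, Phi (c *: f) = normc c `^ p * Phi f) ->
    (forall (t : R) f g, 0 <= t <= 1 ->
      Phi (t%:C *: f + (1 - t)%:C *: g) <= t * Phi f + (1 - t) * Phi g) ->
  forall f g, Phi (f + g) `^ p^-1 <= Phi f `^ p^-1 + Phi g `^ p^-1.
Proof.
move=> p1 Phi0 PhiZ Phic f g.
have p0 : 0 < p by rewrite (lt_trans ltr01).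
have pN0 : p != 0 by rewrite gt_eqF.
pose N f := Phi f `^ p^-1.
have N0 h : 0 <= N h by exact: powR_ge0.
have NE h : N h `^ p = Phi h by rewrite /N -powRrM mulVf// powRr1.
have bound a b : 0 < a -> 0 < b -> N f <= a -> N g <= b -> N (f + g) <= a + b.
  move=> a0 b0 fa gb; have ab0 : 0 < a + b by rewrite addr_gt0.
  pose t := a / (a + b).
  have t01 : 0 <= t <= 1.
    rewrite /t ler_pdivrMr// mul1r lerDl (ltW b0) andbT.
    by rewrite divr_ge0 ?(ltW a0) ?(ltW ab0).
  have tE : 1 - t = b / (a + b) by rewrite /t; field; rewrite gt_eqF.
  have le1 h c : 0 < c -> N h <= c -> Phi (c^-1%:C *: h) <= 1.
    move=> c0 hc; have cV0 : 0 <= c^-1 by rewrite invr_ge0 ltW.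
    rewrite PhiZ normc_real ger0_norm// -NE -powRM//.
    have <- : 1 `^ p = 1 :> R by rewrite powR1.
    apply: ge0_ler_powR; rewrite ?nnegrE ?(ltW p0)//.
      by rewrite mulr_ge0.
    by rewrite mulrC ler_pdivrMr// mul1r.
  have abV0 : 0 <= (a + b)^-1 by rewrite invr_ge0 ltW.
  have : Phi ((a + b)^-1%:C *: (f + g)) <= 1.
    have -> : (a + b)^-1%:C *: (f + g) =
        t%:C *: (a^-1%:C *: f) + (1 - t)%:C *: (b^-1%:C *: g).
      rewrite tE /t !scalerA -!rmorphM/= scalerDr.
      by congr (_%:C *: _ + _%:C *: _); field; rewrite !gt_eqF.
    apply: le_trans (Phic _ _ _ t01) _.
    have /andP[t0 t1] := t01.
    rewrite [leRHS](_ : 1 = t * 1 + (1 - t) * 1); last by ring.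
    by apply: lerD; apply: ler_wpM2l; rewrite ?subr_ge0 ?le1.
  rewrite PhiZ normc_real ger0_norm// -NE -powRM// => le1'.
  have : ((a + b)^-1 * N (f + g)) `^ p `^ p^-1 <= 1 `^ p^-1.
    by apply: ge0_ler_powR; rewrite ?nnegrE ?powR_ge0 ?invr_ge0 ?(ltW p0).
  rewrite -powRrM mulfV// powRr1 ?powR1; last by rewrite mulr_ge0.
  by rewrite mulrC ler_pdivrMr// mul1r.
apply/ler_addgt0Pr => e e0.
have e20 : 0 < e / 2 by rewrite divr_gt0.
have -> : Phi f `^ p^-1 + Phi g `^ p^-1 + e = (N f + e / 2) + (N g + e / 2).
  by rewrite /N; field.
by apply: bound; rewrite ?ltr_wpDl ?lerDl ?(ltW e20).
Qed.

Section Dirichlet.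
Context {R : realType} {G : groupType}.
Variable S : generating_set G.
Implicit Types (f : G -> R[i]) (s x g : G).

Definition translate x f : G -> R[i] := fun g => f (g * x^-1)%g.

Definition in_Dp (p : R) f : Prop := forall s, s \in generators S ->
  (\esum_(g in [set: G]) (normc (f (g * s^-1)%g - f g) `^ p)%:E < +oo)%E.

Definition Dp_energy (p : R) f : \bar R :=
  (\sum_(s <- generators S)
    \esum_(g in [set: G]) (normc (f (g * s^-1)%g - f g) `^ p)%:E)%E.

Definition Dp_seminorm (p : R) f : R := fine (Dp_energy p f) `^ p^-1.

Definition Dp_banach_norm (p : R) f : R :=
  (Dp_seminorm p f `^ p + normc (f 1%g) `^ p) `^ p^-1.

(* The proof of 1 < p is a parameter of the predicates, hence of the types Dp
   and BDp below, because closure under addition depends on it. *)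
Definition Dp_pred (p : R) (p1 : 1 < p) : {pred G -> R[i]} :=
  [pred f | `[< in_Dp p f >]].

Definition BDp_pred (p : R) (p1 : 1 < p) : {pred G -> R[i]} :=
  [pred f | `[< in_Dp p f /\ exists M : R, forall g, normc (f g) <= M >]].

Section theory.
Context {p : R}.
Hypothesis p1 : 1 < p.

Lemma in_DpE f :
  in_Dp p f <-> forall s, s \in generators S ->
    (lpsum p (translate s f - f)%R < +oo)%E.
Proof. by []. Qed.

Lemma translateD x f h : translate x (f + h) = translate x f + translate x h.
Proof. by []. Qed.

Lemma translateZ x (c : R[i]) f : translate x (c *: f) = c *: translate x f.
Proof. by []. Qed.

Lemma translateN x f : translate x (- f) = - translate x f.
Proof. by []. Qed.

Lemma translateM x y f : translate x (translate y f) = translate (y * x)%g f.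
Proof. by apply/funext => g; rewrite /translate invgM mulgA. Qed.

Lemma translate1 f : translate 1%g f = f.
Proof. by apply/funext => g; rewrite /translate invg1 mulg1. Qed.

Lemma in_DpD f h : in_Dp p f -> in_Dp p h -> in_Dp p (f + h).
Proof.
move=> /in_DpE Df /in_DpE Dg; apply/in_DpE => s sS.
rewrite translateD opprD addrACA.
by apply: lpsum_finD => //; [exact: Df|exact: Dg].
Qed.

Lemma in_DpZ c f : in_Dp p f -> in_Dp p (c *: f).
Proof.
move=> /in_DpE Df; apply/in_DpE => s sS.
by rewrite translateZ -scalerBr lpsum_finZ ?Df.
Qed.

Lemma lpsum0 : lpsum p (0 : G -> R[i]) = 0%E.
Proof.
apply: esum1 => g _; rewrite [X in X `^ _](_ : _ = 0); last exact: normc0.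
by rewrite powR0// gt_eqF// (lt_trans ltr01).
Qed.

Lemma in_Dp_cst c : in_Dp p (cst c).
Proof.
apply/in_DpE => s sS; rewrite (_ : translate _ _ - _ = 0) ?lpsum0//.
by apply/funext => g; rewrite /translate/= -[LHS]/(c - c) subrr.
Qed.

Lemma lpsum_translate x u : lpsum p (translate x u) = lpsum p u.
Proof.
rewrite /lpsum [RHS](reindex_esum [set: G] _ (fun g => g * x^-1)%g)//=.
rewrite setTT_bijective; exists (fun g => g * x)%g => g.
- by rewrite -mulgA mulVg mulg1.
- by rewrite -mulgA mulgV mulg1.
Qed.

Lemma in_Dp_diff f x : in_Dp p f -> (lpsum p (translate x f - f)%R < +oo)%E.
Proof.
move=> /in_DpE Df.
pose H := [set y : G | lpsum p (translate y f - f)%R < +oo]%E.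
suff HT : H = [set: G] by have : H x by rewrite HT.
apply: (generatorsT (g := S)) => //; split=> [|y z Hy Hz|y Hy]; rewrite /H/=.
- by rewrite translate1 subrr lpsum0.
- rewrite -translateM (_ : _ - f = translate z (translate y f - f) +
    (translate z f - f)); last by rewrite translateD translateN addrA subrK.
  by rewrite lpsum_finD// lpsum_translate.
- rewrite (_ : _ - f = (-1) *: translate y^-1%g (translate y f - f)).
    by rewrite lpsum_finZ// lpsum_translate.
  by rewrite translateD translateN translateM mulgV translate1 scaleN1r opprB.
Qed.

Lemma in_Dp_translate x f : in_Dp p f -> in_Dp p (translate x f).
Proof.
move=> Df; apply/in_DpE => s sS; rewrite translateM.
rewrite (_ : _ - _ = (translate (x * s)%g f - f) + (-1) *: (translate x f - f)).
  apply: lpsum_finD => //; first exact: in_Dp_diff.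
  by apply: lpsum_finZ; exact: in_Dp_diff.
by rewrite scaleN1r opprB subrKA.
Qed.

Fact Dp_submod_closed : GRing.subsemimod_closed (Dp_pred p1).
Proof.
split; [split|].
- by apply/asboolP; exact: (in_Dp_cst 0).
- by move=> f g /asboolP Df /asboolP Dg; apply/asboolP; exact: in_DpD.
- by move=> c f /asboolP Df; apply/asboolP; exact: in_DpZ.
Qed.

End theory.
End Dirichlet.

Section Dp_type.
Context {R : realType} {G : groupType}.
Variables (S : generating_set G) (p : R) (p1 : 1 < p).

Record Dp := MkDp { Dp_fun :> G -> R[i]; _ : Dp_fun \in Dp_pred S p1 }.

HB.instance Definition _ := [isSub for Dp_fun].
HB.instance Definition _ := [Choice of Dp by <:].
HB.instance Definition _ :=
  GRing.SubChoice_isSubLmodule.Build _ _ _ Dp (Dp_submod_closed S p1).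

Record BDp := MkBDp { BDp_fun :> G -> R[i]; _ : BDp_fun \in BDp_pred S p1 }.

End Dp_type.

Section norms.
Context {R : realType} {G : groupType} {p : R}.
Variables (S : generating_set G) (p1 : 1 < p).
Implicit Types (f : G -> R[i]) (u : Dp S p1).

Local Notation Phi f := (fine (Dp_energy S p f)).

Let p0 : 0 < p. Proof. by rewrite (lt_trans ltr01). Qed.

Lemma lpsum_eq0 f : lpsum p f = 0%E -> f = 0.
Proof.
move=> f0; apply/funext => g; apply: eq0_normc; apply/eqP.
have : ((normc (f g) `^ p)%:E <= 0)%E.
  rewrite -f0; apply: esum_ge; exists [set g]; first by split.
  by rewrite fsbig_set1.
rewrite lee_fin le_eqVlt ltNge powR_ge0 orbF.
by rewrite powR_eq0 => /andP[].
Qed.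

Lemma Dp_funP u : in_Dp S p u.
Proof. by case: u => f /= /asboolP. Qed.

Lemma Dp_energyE f :
  Dp_energy S p f = (\sum_(s <- generators S) lpsum p (translate s f - f)%R)%E.
Proof. by []. Qed.

Lemma Dp_energy_fin f : in_Dp S p f -> (Dp_energy S p f) \is a fin_num.
Proof.
move=> /in_DpE Df; rewrite Dp_energyE big_seq; apply/sum_fin_numP => s _ sS.
by rewrite ge0_fin_numE ?lpsum_ge0// Df.
Qed.

Lemma Dp_energy_ge0 f : (0 <= Dp_energy S p f)%E.
Proof. by rewrite Dp_energyE; apply: sume_ge0 => s _; exact: lpsum_ge0. Qed.

Lemma Phi_ge0 f : 0 <= Phi f.
Proof. exact/fine_ge0/Dp_energy_ge0. Qed.

Lemma Dp_energyZ c f :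
  Dp_energy S p (c *: f)%R = ((normc c `^ p)%:E * Dp_energy S p f)%E.
Proof.
rewrite !Dp_energyE ge0_sume_distrr; last by move=> s _; exact: lpsum_ge0.
by apply: eq_bigr => s _; rewrite translateZ -scalerBr lpsumZ.
Qed.

Lemma PhiZ c u : Phi (c *: u) = normc c `^ p * Phi u.
Proof.
by rewrite -[X in Dp_energy _ _ X]/(c *: (u : G -> R[i])) Dp_energyZ fineM//
  Dp_energy_fin//; exact: Dp_funP.
Qed.

Lemma Phi_conv (t : R) u v : 0 <= t <= 1 ->
  Phi (t%:C *: u + (1 - t)%:C *: v) <= t * Phi u + (1 - t) * Phi v.
Proof.
move=> t01; have /andP[t0 t1] := t01.
have := Dp_energy_fin (Dp_funP u); have := Dp_energy_fin (Dp_funP v).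
move=> vf uf.
rewrite -lee_fin EFinD !EFinM !fineK//; last first.
  by apply: Dp_energy_fin; exact: Dp_funP.
rewrite !Dp_energyE !ge0_sume_distrr; last 2 first.
- by move=> s _; exact: lpsum_ge0.
- by move=> s _; exact: lpsum_ge0.
rewrite -big_split/=; apply: lee_sum => s _.
apply: le_trans (lpsum_conv _ _ p1 t01); rewrite le_eqVlt; apply/orP; left.
apply/eqP; congr lpsum.
by rewrite -[X in translate s X]/(t%:C *: (u : G -> R[i]) + (1 - t)%:C *: (v : G -> R[i]))
  translateD !translateZ !scalerBr addrACA -opprD.
Qed.

Lemma Dp_seminormE u : Dp_seminorm S p u `^ p = Phi u.
Proof. by rewrite /Dp_seminorm -powRrM mulVf ?gt_eqF// powRr1// Phi_ge0. Qed.

Lemma Dp_seminorm_ge0 f : 0 <= Dp_seminorm S p f.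
Proof. exact: powR_ge0. Qed.

Lemma Dp_seminormD u v :
  Dp_seminorm S p (u + v) <= Dp_seminorm S p u + Dp_seminorm S p v.
Proof.
apply: (@root_triangle _ (Dp S p1) p (fun u => Phi u)) => //.
- by move=> ?; exact: Phi_ge0.
- by move=> ? ?; exact: PhiZ.
- by move=> ? ? ? ?; exact: Phi_conv.
Qed.

Lemma root_powR (a : R) : 0 <= a -> (a `^ p) `^ p^-1 = a.
Proof. by move=> a0; rewrite -powRrM mulfV ?gt_eqF// powRr1. Qed.

Lemma Dp_seminormZ c u : Dp_seminorm S p (c *: u) = normc c * Dp_seminorm S p u.
Proof.
by rewrite /Dp_seminorm PhiZ powRM ?powR_ge0 ?Phi_ge0// root_powR ?normc_ge0.
Qed.

Lemma Dp_seminorm_cst c u v : (forall g, v g = u g + c) ->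
  Dp_seminorm S p v = Dp_seminorm S p u.
Proof.
move=> vE; congr (fine _ `^ _); rewrite !Dp_energyE.
apply: eq_bigr => s _; congr lpsum; apply/funext => g.
by rewrite !fctE /translate !vE opprD addrACA subrr addr0.
Qed.

Lemma Dp_seminorm_eq0 u : Dp_seminorm S p u = 0 -> exists c, forall g, u g = c.
Proof.
move=> /eqP; rewrite /Dp_seminorm powR_eq0 => /andP[/eqP Phi0 _].
have E0 : Dp_energy S p u = 0%E.
  by rewrite -[LHS]fineK ?Phi0// Dp_energy_fin//; exact: Dp_funP.
pose H := [set x : G | forall g, u (g * x^-1)%g = u g].
have HT : H = [set: G].
  apply: (generatorsT (g := S)).
    split=> [g|x y Hx Hy g|x Hx g]; first by rewrite invg1 mulg1.
      by rewrite invgM mulgA Hx Hy.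
    by rewrite -(Hx (g * x^-1^-1)%g) -mulgA mulVg mulg1.
  move=> s sS g; apply/eqP; rewrite -subr_eq0; apply/eqP.
  have : lpsum p (translate s u - u) = 0%E.
    move: E0 => /eqP; rewrite Dp_energyE seq_psume_eq0; last first.
      by move=> ? _; exact: lpsum_ge0.
    by move=> /allP /(_ _ sS) /= /eqP.
  by move=> /lpsum_eq0 /(congr1 (@^~ g)).
exists (u 1%g) => g; have : H g^-1%g by rewrite HT.
by move=> /(_ 1%g); rewrite invgK mul1g.
Qed.

Let Psi u := Phi u + normc (u 1%g) `^ p.

Lemma Dp_banach_normE u : Dp_banach_norm S p u = Psi u `^ p^-1.
Proof. by rewrite /Dp_banach_norm Dp_seminormE. Qed.

Lemma Dp_banach_normD u v :
  Dp_banach_norm S p (u + v) <= Dp_banach_norm S p u + Dp_banach_norm S p v.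
Proof.
rewrite !Dp_banach_normE; apply: root_triangle => //.
- by move=> f; rewrite addr_ge0 ?Phi_ge0 ?powR_ge0.
- move=> c f; rewrite /Psi PhiZ mulrDr; congr (_ + _).
  by rewrite -powRM ?normc_ge0// -normcM.
- move=> t f g t01; rewrite /Psi !mulrDr addrACA; apply: lerD.
    exact: Phi_conv.
  exact: normc_conv.
Qed.

Lemma Dp_banach_normZ c u :
  Dp_banach_norm S p (c *: u) = normc c * Dp_banach_norm S p u.
Proof.
rewrite !Dp_banach_normE /Psi PhiZ normcM powRM ?normc_ge0// -mulrDr.
by rewrite powRM ?addr_ge0 ?powR_ge0 ?Phi_ge0// root_powR ?normc_ge0.
Qed.

Lemma Dp_banach_norm_eq0 u : Dp_banach_norm S p u = 0 -> u = 0.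
Proof.
move=> /eqP; rewrite Dp_banach_normE powR_eq0 => /andP[+ _].
rewrite paddr_eq0 ?Phi_ge0 ?powR_ge0// => /andP[/eqP Phi0].
rewrite powR_eq0 => /andP[/eqP/eq0_normc u10 _].
have [|c uE] := @Dp_seminorm_eq0 u.
  by rewrite /Dp_seminorm Phi0 powR0// invr_neq0// gt_eqF.
by apply/val_inj/funext => g; rewrite /= uE -(uE 1%g) u10.
Qed.

Fact Dp_normC_triangle u v :
  (Dp_banach_norm S p (u + v))%:C <=
  (Dp_banach_norm S p u)%:C + (Dp_banach_norm S p v)%:C.
Proof. by rewrite -rmorphD lecR Dp_banach_normD. Qed.

Fact Dp_normCZ c u :
  (Dp_banach_norm S p (c *: u))%:C = `|c| * (Dp_banach_norm S p u)%:C.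
Proof. by rewrite normcE -rmorphM Dp_banach_normZ. Qed.

Fact Dp_normC_eq0 u : (Dp_banach_norm S p u)%:C = 0 -> u = 0.
Proof. by move=> [] /Dp_banach_norm_eq0. Qed.

End norms.

(* Norms of normed modules over R[i] take values in R[i], whence the %:C. *)
HB.instance Definition _ (R : realType) (G : groupType) (S : generating_set G)
    (p : R) (p1 : 1 < p) :=
  @Lmodule_isNormed.Build R[i] (Dp S p1) (fun u => (Dp_banach_norm S p u)%:C)
    (@Dp_normC_triangle R G p S p1) (@Dp_normCZ R G p S p1)
    (@Dp_normC_eq0 R G p S p1).

Section quotient_by_constants.
Context {R : realType} {G : groupType} {p : R}.
Variables (S : generating_set G) (p1 : 1 < p).
Local Notation D := (Dp S p1).

Definition Dp_cst : {pred D} := [pred u : D | `[< exists c, forall g, u g = c >]].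

Fact Dp_cst_zmod_closed : zmod_closed Dp_cst.
Proof.
split; first by apply/asboolP; exists 0.
move=> u v /asboolP[c uE] /asboolP[d vE]; apply/asboolP; exists (c - d) => g.
by rewrite -[LHS]/(u g - v g) uE vE.
Qed.

HB.instance Definition _ := GRing.isZmodClosed.Build D Dp_cst Dp_cst_zmod_closed.

(* D_p(G)/C, with DpC_class the quotient map and repr a section of it; scaling,
   norm and translation are given on representatives, and the lemmas
   DpC_scale_class, DpC_norm_class and DpC_translate_class show that they do
   not depend on the representative. *)
Definition DpC := Quotient.quot Dp_cst.

HB.instance Definition _ := EqQuotient.on DpC.
HB.instance Definition _ := Choice.on DpC.
HB.instance Definition _ := GRing.Zmodule.on DpC.

Definition DpC_class : D -> DpC := (\pi_DpC)%qT.

Lemma DpC_classE u v : (DpC_class u = DpC_class v) <-> (exists c, forall g, u g = v g + c).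
Proof.
rewrite /DpC_class; split=> [/eqP|[c uvE]].
  rewrite -Quotient.idealrBE => /asboolP[c uvE]; exists c => g.
  by rewrite -(uvE g) -[X in _ = _ + X]/(u g - v g) addrCA subrr addr0.
apply/eqP; rewrite -Quotient.idealrBE; apply/asboolP; exists c => g.
by rewrite -[LHS]/(u g - v g) uvE addrAC subrr add0r.
Qed.

Lemma DpC_reprK q : DpC_class (repr q) = q.
Proof. exact: reprK. Qed.

Lemma repr_DpC u : exists c, forall g, (repr (DpC_class u)) g = u g + c.
Proof. by apply/DpC_classE; rewrite DpC_reprK. Qed.

Lemma DpC_classD u v : DpC_class (u + v) = DpC_class u + DpC_class v.
Proof. exact: raddfD. Qed.

Definition DpC_scale (c : R[i]) (q : DpC) : DpC := DpC_class (c *: repr q).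

Lemma DpC_scale_class c u : DpC_scale c (DpC_class u) = DpC_class (c *: u).
Proof.
apply/DpC_classE; have [d uE] := repr_DpC u; exists (c * d) => g.
by rewrite -[LHS]/(c * repr (DpC_class u) g) uE mulrDr.
Qed.

Fact DpC_scaleA a b q : DpC_scale a (DpC_scale b q) = DpC_scale (a * b) q.
Proof. by rewrite -(DpC_reprK q) !DpC_scale_class scalerA. Qed.

Fact DpC_scale1 : left_id 1 DpC_scale.
Proof. by move=> q; rewrite -(DpC_reprK q) DpC_scale_class scale1r. Qed.

Fact DpC_scaleDr : right_distributive DpC_scale +%R.
Proof.
move=> c q r; rewrite -(DpC_reprK q) -(DpC_reprK r) -DpC_classD.
by rewrite !DpC_scale_class scalerDr DpC_classD.
Qed.

Fact DpC_scaleDl q : {morph DpC_scale^~ q : a b / a + b}.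
Proof.
by move=> a b; rewrite -(DpC_reprK q) !DpC_scale_class scalerDl DpC_classD.
Qed.

HB.instance Definition _ := GRing.Zmodule_isLmodule.Build R[i] DpC
  DpC_scaleA DpC_scale1 DpC_scaleDr DpC_scaleDl.

Definition DpC_norm (q : DpC) : R := Dp_seminorm S p (repr q).

Lemma DpC_norm_class u : DpC_norm (DpC_class u) = Dp_seminorm S p u.
Proof. by have [c uE] := repr_DpC u; exact: Dp_seminorm_cst uE. Qed.

Fact DpC_normC_triangle q r :
  (DpC_norm (q + r))%:C <= (DpC_norm q)%:C + (DpC_norm r)%:C.
Proof.
rewrite -rmorphD lecR -(DpC_reprK q) -(DpC_reprK r) -DpC_classD.
by rewrite !DpC_norm_class Dp_seminormD.
Qed.

Fact DpC_normCZ c q : (DpC_norm (c *: q))%:C = `|c| * (DpC_norm q)%:C.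
Proof.
rewrite normcE -rmorphM -(DpC_reprK q) -[c *: _]/(DpC_scale _ _).
by rewrite DpC_scale_class !DpC_norm_class Dp_seminormZ.
Qed.

Fact DpC_normC_eq0 q : (DpC_norm q)%:C = 0 -> q = 0.
Proof.
rewrite -(DpC_reprK q) => -[]; rewrite DpC_norm_class.
move=> /Dp_seminorm_eq0[c uE].
have -> : 0 = DpC_class 0 by rewrite /DpC_class raddf0.
by apply/DpC_classE; exists c => g; rewrite uE -[X in X + _]/(0 : R[i]) add0r.
Qed.

HB.instance Definition _ := @Lmodule_isNormed.Build R[i] DpC
  (fun q => (DpC_norm q)%:C) DpC_normC_triangle DpC_normCZ DpC_normC_eq0.

Fact Dp_translate_subproof x (u : D) : translate x u \in Dp_pred S p1.
Proof. by apply/asboolP; apply: in_Dp_translate => //; exact: Dp_funP. Qed.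

Definition Dp_translate (x : G) (u : D) : D := MkDp (Dp_translate_subproof x u).

Definition DpC_translate (x : G) (q : DpC) : DpC :=
  DpC_class (Dp_translate x (repr q)).

Lemma DpC_translate_class x u :
  DpC_translate x (DpC_class u) = DpC_class (Dp_translate x u).
Proof.
apply/DpC_classE; have [c uE] := repr_DpC u; exists c => g.
by rewrite -[LHS]/(repr (DpC_class u) (g * x^-1)%g) uE.
Qed.

Definition translation_invariant (T : DpC -> R[i]) : Prop :=
  forall q x, T (DpC_translate x q) = T q.

End quotient_by_constants.

Section boundary.
Context {R : realType} {G : groupType} {p : R}.
Variables (S : generating_set G) (p1 : 1 < p).
Local Notation D := (Dp S p1).
Local Notation BD := (BDp S p1).

HB.instance Definition _ := [isSub for @BDp_fun R G S p p1].
HB.instance Definition _ := [Choice of BD by <:].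

Fact BDp_submod_closed : GRing.subsemimod_closed (BDp_pred S p1).
Proof.
split; [split|].
- apply/asboolP; split; first exact: (in_Dp_cst p1 0).
  by exists 0 => g; rewrite [normc _]normc0.
- move=> f h /asboolP[Df [M fM]] /asboolP[Dh [N hN]]; apply/asboolP.
  split; first exact: in_DpD.
  by exists (M + N) => g; rewrite (le_trans (normcD _ _))// lerD.
- move=> c f /asboolP[Df [M fM]]; apply/asboolP.
  split; first exact: in_DpZ.
  by exists (normc c * M) => g; rewrite [normc _]normcM ler_wpM2l ?normc_ge0.
Qed.

HB.instance Definition _ :=
  GRing.SubChoice_isSubLmodule.Build _ _ _ BD BDp_submod_closed.

Lemma lpsum_finM (f h : G -> R[i]) (M : R) : (forall g, normc (f g) <= M) ->
  (lpsum p h < +oo)%E -> (lpsum p (f * h)%R < +oo)%E.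
Proof.
move=> fM hfin; have M0 : 0 <= M by apply: le_trans (fM 1%g); exact: normc_ge0.
apply: le_lt_trans (lpsum_finZ M%:C hfin); apply: le_esum => g _.
rewrite lee_fin; apply: ge0_ler_powR; rewrite ?nnegrE ?normc_ge0//.
  by rewrite ltW// (lt_trans ltr01).
rewrite [X in X <= _]normcM [X in _ <= X]normcM normc_real ger0_norm//.
by rewrite ler_wpM2r ?normc_ge0.
Qed.

Fact BDp_subring_closed : subring_closed (BDp_pred S p1).
Proof.
split.
- apply/asboolP; split; first exact: (in_Dp_cst p1 1).
  by exists 1 => g; rewrite [normc _]normc1.
- move=> f h Bf Bh; rewrite -scaleN1r.
  have [[_ BDD] BDZ] := BDp_submod_closed.
  by apply: BDD => //; exact: BDZ.
move=> f h /asboolP[/in_DpE Df [M fM]] /asboolP[/in_DpE Dh [N hN]].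
apply/asboolP; split; last first.
  exists (M * N) => g; rewrite [normc _]normcM.
  by apply: ler_pM; rewrite ?normc_ge0.
apply/in_DpE => s sS.
rewrite (_ : _ - _ = translate s f * (translate s h - h) +
                     h * (translate s f - f)).
  apply: lpsum_finD => //.
    by apply: (@lpsum_finM _ _ M); [move=> g; exact: fM|exact: Dh].
  by apply: (@lpsum_finM _ _ N); [move=> g; exact: hN|exact: Df].
apply/funext => g; rewrite !fctE /translate.
by rewrite -[LHS]/(f (g * s^-1)%g * h (g * s^-1)%g - f g * h g); ring.
Qed.

HB.instance Definition _ :=
  GRing.SubZmodule_isSubPzRing.Build _ _ BD BDp_subring_closed.
HB.instance Definition _ := GRing.SubPzRing_isSubComPzRing.Build _ _ BD.

Fact BDp_inclusion_subproof (u : BD) : (u : G -> R[i]) \in Dp_pred S p1.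
Proof. by case: u => f /= /asboolP[Df _]; apply/asboolP. Qed.

Definition BDp_inclusion (u : BD) : D := MkDp (BDp_inclusion_subproof u).

(* The finitely supported functions, as a subset of the normed space D_p(G);
   closure below is taken in the topology of Dp_banach_norm. *)
Definition finitely_supported : set D :=
  [set u | finite_set [set g | u g != 0]].

Definition B_closure : set BD :=
  [set u | closure finitely_supported (BDp_inclusion u)].

(* Nonzero homomorphisms of complex algebras; nothing about the unit or about
   continuity is required. Only the underlying set is needed here, not its
   weak-* topology. *)
Definition Sp : set (BD -> R[i]) :=
  [set tau : BD -> R[i] | [/\ scalar tau, {morph tau : u v / u * v} & exists u, tau u != 0]].

Definition evaluation (g : G) : BD -> R[i] := fun u => u g.

Definition p_harmonic_boundary : set (BD -> R[i]) :=
  (Sp `\` range evaluation) `&` [set tau | forall u, B_closure u -> tau u = 0].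

End boundary.

Arguments finitely_supported {R G p} S p1.
Arguments B_closure {R G p} S p1.
Arguments Sp {R G p} S p1.
Arguments p_harmonic_boundary {R G p} S p1.

(* Main.v *)
Require Import Defs.
From HB Require Import structures.
From mathcomp Require Import all_boot all_order all_algebra finmap.
From mathcomp Require Import complex ring lra.
From mathcomp Require Import all_classical all_reals all_analysis.

Set Implicit Arguments.
Unset Strict Implicit.
Unset Printing Implicit Defensive.

Import Order.TTheory GRing.Theory Num.Theory.
Import numFieldNormedType.Exports.

Local Open Scope classical_set_scope.
Local Open Scope ring_scope.

(* Let I be the set of bounded functions in the D_p-closure of CG. It is an
   ideal of BD_p: if u_n in CG tends to a bounded u, then clamping u_n at the
   size of u and multiplying by h in BD_p stays in CG and tends to uh, by
   dominated convergence.

   If h in BD_p is not in I, some character of the boundary does not vanish at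
   h: for some e > 0 the sets {|u| < d} (u in I, d > 0) all meet {|h| >= e},
   since otherwise every soft threshold of h would be a multiple of an element
   of I and h would be a limit of elements of I. A limit along an ultrafilter
   containing all these sets is the required character. Applying this to f and
   then to f - tau(f), there are two boundary characters as soon as some
   bounded f lies outside I + C; the converse is immediate.

   A continuous invariant functional kills the point masses, hence I + C, and
   bounded functions are dense. Conversely, if f - c is never in I and 1 is not
   in I, Hahn-Banach gives functionals T1, T2 on D_p vanishing on CG, with
   T1(1) <> 0 and T2(f - c) <> 0 for c = T1(f) / T1(1). Then
   T2 - (T2(1) / T1(1)) T1 vanishes on the constants but not at f, and it is
   invariant because f_x - f is p-summable, so in the closure of CG. *)
Import ComplexField.Normc.
Local Open Scope complex_scope.

Local Notation Re := complex.Re.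
Local Notation Im := complex.Im.

(** The sum is at most twice the larger term; the crude constant is later absorbed by small
    parameters. *)
Lemma powRD_le (R : realType) (p x y : R) : 0 <= p -> 0 <= x -> 0 <= y ->
  (x + y) `^ p <= 2 `^ p * (x `^ p + y `^ p).
Proof.
move=> p0 x0 y0.
have main a b : 0 <= a -> a <= b -> (a + b) `^ p <= 2 `^ p * (a `^ p + b `^ p).
  move=> a0 ab; have b0 := le_trans a0 ab.
  apply: (@le_trans _ _ ((2 * b) `^ p)).
    by apply: ge0_ler_powR => //; rewrite ?nnegrE; lra.
  by rewrite powRM// ler_wpM2l ?powR_ge0// lerDr powR_ge0.
have [xy|/ltW yx] := leP x y; first exact: main.
by rewrite addrC [x `^ p + _]addrC main.
Qed.

(** * Dominated convergence for p-th power sums *)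

Section lpsum_domination.
Context {R : realType} {G : choiceType}.
Implicit Types (p : R) (u v w : G -> R[i]).

Lemma le_lpsum p u v : 0 <= p -> (forall g, normc (u g) <= normc (v g)) ->
  (lpsum p u <= lpsum p v)%E.
Proof.
move=> p0 uv; apply: le_esum => g _; rewrite lee_fin.
by apply: ge0_ler_powR; rewrite ?nnegrE ?normc_ge0.
Qed.

Lemma esum_tail (a : G -> \bar R) (e : R) : (forall g, 0 <= a g)%E ->
  (\esum_(g in [set: G]) a g < +oo)%E -> 0 < e ->
  exists A : {fset G}, (\esum_(g in ~` [set` A]) a g <= e%:E)%E.
Proof.
move=> a0 afin e0.
have sfin : (\esum_(g in [set: G]) a g)%E \is a fin_num.
  by rewrite ge0_fin_numE// esum_ge0.
have [_ [A [finA _] <-] eA] := ub_ereal_sup_adherent e0 sfin.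
have [B AB] := finite_fsetP.1 finA; subst A.
exists B; move: sfin eA; rewrite -/(esum _ _) (esumID [set` B])// !setTI.
rewrite esum_fset//; set x := (\sum_(_ \in _) _)%E; set y := esum _ _.
move=> /[dup] xyfin; rewrite fin_numD => /andP[xfin yfin].
by rewrite lteBlDr// lteD2lE// => /ltW.
Qed.

(** Dominated convergence without sequences: a finite set [A] carries all of the sum of [w] but a
    small tail. On [A] pointwise smallness of [u] is enough; off [A] the bound by [v] and [w] takes
    over. [A] and [d0] are chosen before [u] and [v]. *)
Lemma lpsum_small p w (e : R) : 0 < p -> (lpsum p w < +oo)%E -> 0 < e ->
  exists (A : {fset G}) (d0 : R), 0 < d0 /\
    forall (d : R) u v, d <= d0 -> (forall g, g \in A -> normc (u g) <= d) ->
      (lpsum p v <= d%:E)%E -> (forall g, normc (u g) <= normc (v g) + normc (w g)) ->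
    (lpsum p u <= e%:E)%E.
Proof.
move=> p0 wfin e0; have pge0 := ltW p0.
have pN0 : p != 0 by rewrite gt_eqF.
pose c : R := 2 `^ p; have c0 : 0 < c by rewrite powR_gt0.
(* Off [A] the estimate is [c * (e1 + e1)], that is two thirds of [e]; the finite set contributes
   the remaining third. *)
pose e1 := e / (3 * c); have e10 : 0 < e1 by rewrite divr_gt0 ?mulr_gt0.
have [|A tailA] := esum_tail _ wfin e10.
  by move=> g; rewrite lee_fin powR_ge0.
(* The added 1 keeps [N] positive for empty [A]. *)
pose N : R := #|` A|%:R + 1.
have N0 : 0 < N by rewrite ltr_wpDl.
pose d1 := (e / (3 * N)) `^ p^-1.
have d10 : 0 < d1 by rewrite powR_gt0 ?divr_gt0 ?mulr_gt0.
exists A, (Num.min e1 d1); split; first by rewrite lt_min e10 d10.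
move=> d u v; rewrite le_min => /andP[de1 dd1] uA vd uvw.
rewrite /lpsum (esumID [set` A])//; last by move=> g _; rewrite lee_fin powR_ge0.
rewrite !setTI esum_fset//; last by move=> g _; rewrite lee_fin powR_ge0.
have -> : e%:E = ((e / 3)%:E + (e * 2 / 3)%:E)%E.
  by rewrite -EFinD; congr EFin; field.
apply: leeD.
  rewrite fsbig_finite//= set_fsetK.
  apply: (@le_trans _ _ (\sum_(g <- A) (e / (3 * N))%:E)%E).
    rewrite big_seq [leRHS]big_seq; apply: lee_sum => g gA; rewrite lee_fin.
    apply: (@le_trans _ _ (d1 `^ p)).
      have /le_trans/(_ dd1) ug := uA _ gA.
      by apply: ge0_ler_powR; rewrite ?nnegrE ?normc_ge0// ltW.
    by rewrite /d1 -powRrM mulVf// powRr1// ltW// divr_gt0// mulr_gt0.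
  rewrite sumEFin lee_fin big_const_seq count_predT iter_addr_0 -(mulr_natr (e / _)).
  rewrite (_ : e / 3 = e / (3 * N) * N); last by field; rewrite gt_eqF.
  by rewrite ler_wpM2l ?lerDl// ltW// divr_gt0// mulr_gt0.
apply: (@le_trans _ _ (\esum_(g in ~` [set` A])
    (c%:E * ((normc (v g) `^ p)%:E + (normc (w g) `^ p)%:E)))%E).
  apply: le_esum => g _; rewrite -EFinD -EFinM lee_fin.
  apply: le_trans (powRD_le _ _ _); rewrite ?normc_ge0//.
  by apply: ge0_ler_powR; rewrite ?nnegrE ?addr_ge0 ?normc_ge0.
rewrite (esum_mkcond (~` _)).
rewrite (eq_esum (b := fun g => c%:E * (if g \in ~` [set` A] then
    (normc (v g) `^ p)%:E + (normc (w g) `^ p)%:E else 0)))%E; last first.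
  by move=> g _; case: ifP => //; rewrite mule0.
rewrite esumZ ?(ltW c0)//; last first.
  by move=> g; case: ifP => // _; rewrite adde_ge0// lee_fin powR_ge0.
rewrite -esum_mkcond esumD; try by move=> g _; rewrite lee_fin powR_ge0.
have -> : (e * 2 / 3)%:E = (c%:E * (e1%:E + e1%:E))%E.
  by rewrite -EFinD -EFinM /e1; congr EFin; field; rewrite gt_eqF.
rewrite lee_pmul2l//; apply: leeD => //.
apply: (@le_trans _ _ d%:E); last by rewrite lee_fin.
apply: le_trans vd; rewrite /lpsum (esumID [set` A] [set: G])//; last first.
  by move=> g _; rewrite lee_fin powR_ge0.
by rewrite !setTI leeDr// esum_ge0// => g _; rewrite lee_fin powR_ge0.
Qed.

End lpsum_domination.

(** * Clamping real and complex values *)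

Section clamp.
Context {R : realType}.
Implicit Types (M x y : R) (z w : R[i]).

Definition clamp M x : R := Num.min M (Num.max (- M) x).

Lemma clamp_lip M x y : `|clamp M x - clamp M y| <= `|x - y|.
Proof.
rewrite /clamp /Num.min /Num.max.
have aux (a b : R) : - b <= a <= b -> `|a| <= b by rewrite ler_norml.
apply: aux; have := ler_norm (x - y); have := ler_norm (- (x - y)).
rewrite normrN; case: (ltP (- M) x) => ?; case: (ltP (- M) y) => ?;
  do 2 case: ltP => ?; move=> ? ?; apply/andP; split; lra.
Qed.

Lemma clamp_bound M x : 0 <= M -> `|clamp M x| <= M.
Proof.
by rewrite ler_norml /clamp /Num.min /Num.max; case: (ltP (- M) x) => ?;
  case: ltP => ?; lra.
Qed.

Lemma clamp_id M x : `|x| <= M -> clamp M x = x.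
Proof.
by rewrite ler_norml /clamp /Num.min /Num.max; case: (ltP (- M) x) => ?;
  case: ltP => ?; lra.
Qed.

Lemma normc_le z w : `|Re z| <= `|Re w| -> `|Im z| <= `|Im w| ->
  normc z <= normc w.
Proof.
case: z w => [a b] [c d] /= ac bd; apply: ler_wsqrtr.
have sq (x y : R) : `|x| <= `|y| -> x ^+ 2 <= y ^+ 2.
  by move=> xy; rewrite -(real_normK (num_real x)) -(real_normK (num_real y)) ler_sqr.
by rewrite lerD// sq.
Qed.

Lemma Re_le_normc z : `|Re z| <= normc z.
Proof.
case: z => a b /=; rewrite -sqrtr_sqr; apply: ler_wsqrtr.
by rewrite lerDl sqr_ge0.
Qed.

Lemma Im_le_normc z : `|Im z| <= normc z.
Proof.
case: z => a b /=; rewrite -sqrtr_sqr; apply: ler_wsqrtr.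
by rewrite lerDr sqr_ge0.
Qed.

(* The clamping is done on real and imaginary parts separately: it is then
   1-Lipschitz for a trivial reason. *)
Definition clampC M z : R[i] := clamp M (Re z) +i* clamp M (Im z).

Lemma clampC_lip M z w : normc (clampC M z - clampC M w) <= normc (z - w).
Proof.
by apply: normc_le; case: z w => [a b] [c d]; rewrite /= clamp_lip.
Qed.

Lemma clampC_id M z : normc z <= M -> clampC M z = z.
Proof.
case: z => a b zM; rewrite /clampC !clamp_id//=.
  exact: le_trans (Im_le_normc (a +i* b)) zM.
exact: le_trans (Re_le_normc (a +i* b)) zM.
Qed.

Lemma clampC_bound M z : 0 <= M -> normc (clampC M z) <= 2 * M.
Proof.
move=> M0; apply: (@le_trans _ _ (normc (M +i* M))).
  by apply: normc_le => /=; rewrite [leRHS]ger0_norm// clamp_bound.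
rewrite /= -[leRHS]ger0_norm ?mulr_ge0// -sqrtr_sqr; apply: ler_wsqrtr.
have := sqr_ge0 M; nra.
Qed.

End clamp.
(** * Complex Hahn-Banach theorem *)

Section hahn_banach.
Context {R : realType} {V : lmodType R[i]}.
Implicit Types (q : V -> R) (x y : V) (t : R).

(** Only nonnegative real scalars occur: the Hahn-Banach argument runs over the reals, and complex
    linearity is recovered at the end. *)
Definition sublinear q :=
  (forall x y, q (x + y) <= q x + q y) /\
  (forall t x, 0 <= t -> q (t%:C *: x) = t * q x).

Lemma sublinear0 q : sublinear q -> q 0 = 0.
Proof. by move=> [_ /(_ 0 0)]; rewrite scaler0 mul0r; exact. Qed.

Lemma sublinearN q x : sublinear q -> - q (- x) <= q x.
Proof. by move=> /[dup] /sublinear0 q0 [/(_ x (- x)) + _]; rewrite subrr q0; lra. Qed.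

(** Serves three times: for the shift along a vector, for the lower bound of a chain and for the
    distance to a subspace. The conditions bear on the family as a whole: the inequality for a sum
    or a multiple may move to another index [k]. *)
Lemma sublinear_inf (I : Type) (P : set I) (F : I -> V -> R) :
    P !=set0 -> (forall x, exists b, forall i, P i -> b <= F i x) ->
    (forall i j x y, P i -> P j -> exists2 k, P k & F k (x + y) <= F i x + F j y) ->
    (forall i t x, P i -> 0 < t -> exists2 k, P k & F k (t%:C *: x) <= t * F i x) ->
    (forall i, P i -> 0 <= F i 0) -> (exists2 i, P i & F i 0 <= 0) ->
  sublinear (fun x => inf [set F i x | i in P]) /\
  forall i x, P i -> inf [set F i x | i in P] <= F i x.
Proof.
move=> [i0 Pi0] Fb FD FZ F0ge [i1 Pi1 F0le]; pose q x := inf [set F i x | i in P].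
have qF i x : P i -> q x <= F i x.
  move=> Pi; apply: ge_inf; last by exists i.
  by have [b bF] := Fb x; exists b => _ [j Pj <-]; exact: bF.
have qge x b : (forall i, P i -> b <= F i x) -> b <= q x.
  move=> bF; apply: lb_le_inf; first by exists (F i0 x), i0.
  by move=> _ [j Pj <-]; exact: bF.
have q0 : q 0 = 0.
  by apply/eqP; rewrite eq_le qge// andbT (le_trans (qF _ _ Pi1)).
have qZ t x : 0 < t -> q (t%:C *: x) <= t * q x.
  move=> t0; rewrite -ler_pdivrMl//; apply: (qge) => i Pi.
  rewrite ler_pdivrMl//; have [k Pk] := FZ i t x Pi t0.
  exact/le_trans/qF.
split=> //; change (sublinear q); split=> [x y|t x].
  rewrite -lerBlDr; apply: (qge) => i Pi; rewrite lerBlDr -lerBlDl.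
  apply: (qge) => j Pj; rewrite lerBlDl; have [k Pk] := FD _ _ x y Pi Pj.
  exact/le_trans/qF.
rewrite le_eqVlt => /predU1P[<-|t0]; first by rewrite mul0r scale0r q0.
apply/eqP; rewrite eq_le qZ// -ler_pdivlMl//.
(* The opposite inequality is [qZ] for the inverse scalar. *)
have := qZ t^-1 (t%:C *: x); rewrite invr_gt0 => /(_ t0).
by rewrite scalerA -rmorphM/= mulVf ?gt_eqF// scale1r.
Qed.

(** Replaces the one-dimensional extension step of Hahn-Banach: instead of enlarging a domain, [q]
    is lowered on the side of [- y]. *)
Lemma sublinear_shift q y : sublinear q ->
  exists q', [/\ sublinear q', forall x, q' x <= q x & q' (- y) <= - q y].
Proof.
move=> /[dup] qsub [qD qZ].
(* The infimum over [t >= 0] is the largest possible [q']. *)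
pose F t x := q (x + t%:C *: y) - t * q y.
have [||||||q'sub q'F] := @sublinear_inf R [set t | 0 <= t] F.
- by exists 0 => /=.
- move=> x; exists (- q (- x)) => t /= t0; rewrite /F -qZ//.
  have := qD (x + t%:C *: y) (- x).
  by rewrite addrAC subrr add0r; lra.
- move=> s t x z /= s0 t0; exists (s + t); rewrite /= ?addr_ge0// /F.
  rewrite rmorphD/= scalerDl addrACA.
  by have := qD (x + s%:C *: y) (z + t%:C *: y); lra.
- move=> s t x /= s0 t0; exists (t * s); first by rewrite mulr_ge0// ltW.
  by rewrite /F rmorphM/= -scalerA -scalerDr qZ ?(ltW t0)// mulrBr mulrA.
- by move=> t /= t0; rewrite /F add0r qZ// subrr.
- by exists 0 => //=; rewrite /F scale0r addr0 sublinear0// mul0r subrr.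
eexists; split; first exact: q'sub.
- move=> x; apply: le_trans (q'F 0 x _) _ => //=.
  by rewrite /F scale0r addr0 mul0r subr0.
- apply: le_trans (q'F 1 (- y) _) _ => //=.
  by rewrite /F scale1r addNr sublinear0// mul1r sub0r.
Qed.

(** Zorn's lemma for the reversed pointwise order: the infimum of a chain is finite because each
    member is bounded below by [- q (- x)]. *)
Lemma minimal_sublinear q : sublinear q -> exists f, [/\ sublinear f,
  forall x, f x <= q x &
  forall f', sublinear f' -> (forall x, f' x <= f x) -> f' = f].
Proof.
move=> qsub.
pose T := {f : V -> R | sublinear f /\ forall x, f x <= q x}.
pose le (a b : T) := `[< forall x, sval b x <= sval a x >].
have Teq (a b : T) : sval a = sval b -> a = b.
  by case: a b => [a Pa] [b Pb] /= ab; exact: eq_exist.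
have [|||A Atot|f fmin] := @Zorn T le.
- by move=> a; apply/asboolP.
- move=> a b c /asboolP ab /asboolP bc; apply/asboolP => x.
  exact: le_trans (bc x) (ab x).
- move=> a b /asboolP ab /asboolP ba; apply/Teq/funext => x.
  by apply/eqP; rewrite eq_le ab ba.
- have [[a0 Aa0]|A0] := pselect (A !=set0); last first.
    exists (exist _ q (conj qsub (fun x => lexx _))) => s As.
    by exfalso; apply: A0; exists s.
  have [||||||fsub fle] := @sublinear_inf T A (fun a => sval a).
  + by exists a0.
  + move=> x; exists (- q (- x)) => -[a [asub aq]] _ /=.
    apply: le_trans (sublinearN x asub); by rewrite lerN2.
  + move=> a b x y Aa Ab; have [/asboolP ab|/asboolP ba] := Atot a b Aa Ab.
    - exists b => //; apply: (le_trans ((svalP b).1.1 x y)).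
      by rewrite lerD2r.
    - exists a => //; apply: (le_trans ((svalP a).1.1 x y)).
      by rewrite lerD2l.
  + by move=> a t x Aa t0; exists a => //; rewrite (svalP a).1.2// ltW.
  + by move=> a Aa; rewrite sublinear0//; exact: (svalP a).1.
  + by exists a0 => //; rewrite sublinear0//; exact: (svalP a0).1.
  have fq x : inf [set sval i x | i in A] <= q x.
    by apply: le_trans (fle a0 x Aa0) _; exact: (svalP a0).2.
  pose P (f : V -> R) := sublinear f /\ forall x, f x <= q x.
  exists (exist P _ (conj fsub fq)) => s As; apply/asboolP => x /=.
  exact: fle.
exists (sval f); split; first exact: (svalP f).1.
  exact: (svalP f).2.
move=> f' f'sub f'f.
have f'q x : f' x <= q x by apply: le_trans (f'f x) _; exact: (svalP f).2.
have := fmin (exist _ f' (conj f'sub f'q)) => /= <- //.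
by apply/asboolP => x /=; exact: f'f.
Qed.

(* By minimality [f] equals its shift along [y], so that [f (- y) <= - f y]. *)
Lemma minimal_sublinearD f : sublinear f ->
    (forall f', sublinear f' -> (forall x, f' x <= f x) -> f' = f) ->
  {morph f : x y / x + y}.
Proof.
move=> /[dup] fsub [fD _] fmin.
have fN y : f (- y) = - f y.
  have [f' [f'sub f'f f'y]] := sublinear_shift y fsub.
  rewrite (fmin _ f'sub f'f) in f'y.
  by apply/eqP; rewrite eq_le f'y -{1}(opprK y) sublinearN.
move=> x y; apply/eqP; rewrite eq_le fD/=.
by have := fD (x + y) (- y); rewrite addrK fN; lra.
Qed.

(** With [d] the distance to [L], shift [d] along [x0] and take a minimal sublinear functional
    below: it is real linear, bounded by [N], zero on [L] and positive at [x0]. Complexifying costs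
    the factor 2, which is harmless. *)
Lemma hahn_banach (N : V -> R) (L : set V) x0 (e : R) :
    (forall x y, N (x + y) <= N x + N y) ->
    (forall c x, N (c *: x) = normc c * N x) ->
    L 0 -> (forall x y, L x -> L y -> L (x + y)) ->
    (forall c x, L x -> L (c *: x)) ->
    0 < e -> (forall v, L v -> e <= N (x0 - v)) ->
  exists T : V -> R[i], [/\ scalar T, forall x, normc (T x) <= 2 * N x,
    forall v, L v -> T v = 0 & T x0 != 0].
Proof.
move=> ND NZ L0 LD LZ e0 eN.
have N0 : N 0 = 0 by rewrite -(scale0r 0) NZ [normc _]normc0 mul0r.
have NN x : N (- x) = N x by rewrite -scaleN1r NZ [normc _]normcN [normc _]normc1 mul1r.
have Nge0 x : 0 <= N x by have := ND x (- x); rewrite subrr N0 NN; lra.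
have [||||||dsub dN] := @sublinear_inf V L (fun v x => N (x - v)).
- by exists 0.
- by move=> x; exists 0 => v _.
- move=> u v x y Lu Lv; exists (u + v); first exact: LD.
  by rewrite opprD addrACA.
- move=> v t x Lv t0; exists (t%:C *: v); first exact: LZ.
  by rewrite -scalerBr NZ normc_real gtr0_norm.
- by [].
- by exists 0; rewrite // subr0 N0.
set d := (fun x => inf _) in dsub dN.
have dx0 : e <= d x0.
  apply: lb_le_inf; first by exists (N (x0 - 0)), 0.
  by move=> _ [v Lv <-]; exact: eN.
(* The shift is what gives [f (- x0) <= - d x0], hence [e <= f x0]. *)
have [d' [d'sub d'd d'x0]] := sublinear_shift x0 dsub.
have [f [fsub fd' fmin]] := minimal_sublinear d'sub.
have fD := minimal_sublinearD fsub fmin.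
have f0 := sublinear0 fsub.
have fN x : f (- x) = - f x by have := fD x (- x); rewrite subrr f0; lra.
have fd x : f x <= d x := le_trans (fd' x) (d'd x).
have fZ t x : f (t%:C *: x) = t * f x.
  have [t0|/ltW t0] := leP 0 t; first exact: fsub.2.
  rewrite -[t in LHS]opprK rmorphN/= scaleNr fN fsub.2 ?oppr_ge0//.
  by rewrite mulNr opprK.
have fx0 : 0 < f x0.
  by have := fd' (- x0); rewrite fN; lra.
have fleN x : `|f x| <= N x.
  have fle y : f y <= N y.
    by apply: le_trans (fd y) _; apply: le_trans (dN 0 y L0) _; rewrite subr0.
  rewrite ler_norml fle andbT.
  by have := fle (- x); rewrite fN NN; lra.
have fL v : L v -> f v = 0.
  move=> Lv; have fle w : L w -> f w <= 0.
    by move=> Lw; apply: le_trans (fd w) _; apply: le_trans (dN w w Lw) _;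
      rewrite subrr N0.
  have LNv : L (- v) by rewrite -scaleN1r; exact: LZ.
  by apply/eqP; rewrite eq_le fle//=; have := fle _ LNv; rewrite fN; lra.
(* The complex linear functional with real part [f]. *)
pose T x : R[i] := f x +i* (- f ('i *: x)).
have TD x y : T (x + y) = T x + T y.
  by rewrite /T scalerDr !fD opprD.
have Ti x : T ('i *: x) = 'i * T x.
  rewrite /T scalerA -expr2 sqr_i scaleN1r fN opprK.
  by apply/eqP; rewrite eq_complex/=; apply/andP; split; apply/eqP; ring.
have Tr t x : T (t%:C *: x) = t%:C * T x.
  rewrite /T scalerA mulrC -scalerA !fZ.
  by apply/eqP; rewrite eq_complex/=; apply/andP; split; apply/eqP; ring.
exists T; split.
- move=> c x y; rewrite TD; congr (_ + _).
  rewrite [c]complexE scalerDl TD -scalerA Ti !Tr.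
  by rewrite mulrDl -mulrA.
- move=> x; apply: (@le_trans _ _ (`|f x| + `|f ('i *: x)|)).
    have -> : T x = (f x)%:C + 'i * (- f ('i *: x))%:C by exact: complexE.
    apply: le_trans (normcD _ _) _; rewrite normcM !normc_real normrN.
    by rewrite [normc 'i]/= expr0n add0r expr1n sqrtr1 mul1r.
  rewrite mulr_natl mulr2n; apply: lerD; first exact: fleN.
  apply: le_trans (fleN _) _.
  by rewrite NZ [normc 'i]/= expr0n add0r expr1n sqrtr1 mul1r.
- by move=> v Lv; rewrite /T !fL ?oppr0//; exact: LZ.
- by rewrite eq_complex/= negb_and gt_eqF.
Qed.

End hahn_banach.

(** * Approximation in D_p(G) *)

Lemma lpsum_normc (R : realType) (G : choiceType) (p : R) (u : G -> R[i]) :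
  lpsum p (fun g => (normc (u g))%:C) = lpsum p u.
Proof. by apply: eq_esum => g _; rewrite normc_real ger0_norm// normc_ge0. Qed.

Section Dp_closure.
Context {R : realType} {G : groupType} {p : R}.
Variables (S : generating_set G) (p1 : 1 < p).
Local Notation D := (Dp S p1).
Local Notation N := (Dp_banach_norm S p).
Implicit Types (f h : G -> R[i]) (u v z : D) (K : set D) (A : {fset G}).

Let p0 : 0 < p. Proof. by rewrite (lt_trans ltr01). Qed.
Let pN0 : p != 0. Proof. by rewrite gt_eqF. Qed.

Definition mkDp f (Df : in_Dp S p f) : D := MkDp (asboolT Df : f \in Dp_pred S p1).

Lemma lpsum_finDreal f h (a b : R) : (lpsum p f < +oo -> lpsum p h < +oo ->
  lpsum p (fun g => (a * normc (f g) + b * normc (h g))%:C) < +oo)%E.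
Proof.
move=> ffin hfin.
rewrite (_ : (fun _ => _) = a%:C *: (fun g => (normc (f g))%:C) +
    b%:C *: (fun g => (normc (h g))%:C)).
  by apply: lpsum_finD => //; apply: lpsum_finZ; rewrite lpsum_normc.
by apply/funext => g; rewrite rmorphD !rmorphM.
Qed.

Lemma in_Dp_dominated f (w : G -> G -> R[i]) :
  (forall s, s \in generators S -> (lpsum p (w s) < +oo)%E) ->
  (forall s g, s \in generators S ->
    normc (f (g * s^-1)%g - f g) <= normc (w s g)) -> in_Dp S p f.
Proof.
move=> wfin fw; apply/in_DpE => s sS; apply: le_lt_trans (wfin _ sS).
by apply: le_lpsum (ltW p0) _ => g; exact: fw.
Qed.

Lemma in_Dp_lpsum f : (lpsum p f < +oo)%E -> in_Dp S p f.
Proof.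
move=> ffin; apply/in_DpE => s sS.
rewrite -scaleN1r; apply: lpsum_finD => //; first by rewrite lpsum_translate.
exact: lpsum_finZ.
Qed.

Lemma Dp_banach_norm_ge0 f : 0 <= N f.
Proof. exact: powR_ge0. Qed.

Lemma Dp_banach_normN u : N (- u) = N u.
Proof. by rewrite -scaleN1r Dp_banach_normZ normcN normc1 mul1r. Qed.

Lemma Dp_banach_norm_lt u (e : R) : 0 < e ->
  fine (Dp_energy S p u) + normc (u 1%g) `^ p < e `^ p -> N u < e.
Proof.
move=> e0 h; rewrite Dp_banach_normE -[ltRHS](root_powR p1 (ltW e0)).
apply: gt0_ltr_powR; rewrite ?invr_gt0// ?nnegrE ?powR_ge0//.
by rewrite addr_ge0 ?powR_ge0// fine_ge0// Dp_energy_ge0.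
Qed.

Lemma Dp_seminorm_le u : Dp_seminorm S p u <= N u.
Proof.
rewrite Dp_banach_normE /Dp_seminorm; apply: ge0_ler_powR.
- by rewrite invr_ge0 ltW.
- by rewrite nnegrE Phi_ge0.
- by rewrite nnegrE addr_ge0 ?Phi_ge0 ?powR_ge0.
- by rewrite lerDl powR_ge0.
Qed.

Lemma normc1_le_Dp u : normc (u 1%g) <= N u.
Proof.
rewrite Dp_banach_normE -[leLHS](root_powR p1) ?normc_ge0//.
apply: ge0_ler_powR.
- by rewrite invr_ge0 ltW.
- by rewrite nnegrE powR_ge0.
- by rewrite nnegrE addr_ge0 ?Phi_ge0 ?powR_ge0.
- by rewrite lerDr Phi_ge0.
Qed.

Lemma lpsum_diff_le u s : s \in generators S ->
  (lpsum p (translate s u - u)%R <= (N u `^ p)%:E)%E.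
Proof.
move=> sS; apply: (@le_trans _ _ (Dp_energy S p u)).
  rewrite Dp_energyE (big_rem s)//= leeDl// sume_ge0// => t _.
  exact: lpsum_ge0.
rewrite -[leLHS]fineK ?lee_fin; last first.
  exact: Dp_energy_fin (Dp_funP u).
rewrite -Dp_seminormE.
by apply: (ge0_ler_powR (ltW p0) (powR_ge0 _ _) (powR_ge0 _ _)); exact: Dp_seminorm_le.
Qed.

Lemma normc_le_lpsum f (a : R) g : 0 <= a -> (lpsum p f <= (a `^ p)%:E)%E ->
  normc (f g) <= a.
Proof.
move=> a0 fa; have : normc (f g) `^ p <= a `^ p.
  rewrite -lee_fin; apply: le_trans fa; apply: esum_ge; exists [set g].
    by split.
  by rewrite fsbig_set1.
move=> h; rewrite -(root_powR p1 (normc_ge0 (f g))) -[leRHS](root_powR p1 a0).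
by apply: ge0_ler_powR; rewrite ?nnegrE ?powR_ge0// invr_ge0 ltW.
Qed.

(** The increments of [u] along a fixed [x] are bounded by a multiple of the norm, uniformly in the
    base point: this holds for generators and passes to products and inverses, hence holds on all of
    [G]. Going from [1%g] to [g] then bounds the evaluation at [g]. *)
Lemma normc_le_Dp (g : G) : exists C : R, forall u, normc (u g) <= C * N u.
Proof.
pose H := [set x : G | exists C : R, forall u k,
  normc (u (k * x^-1)%g - u k) <= C * N u].
suff HT : H = [set: G].
  have : H g^-1%g by rewrite HT.
  move=> [C Cu]; exists (C + 1) => u; rewrite mulrDl mul1r.
  rewrite -[u g](subrK (u 1%g)); apply: le_trans (normcD _ _) _.
  by apply: lerD; [have := Cu u 1%g; rewrite invgK mul1g|exact: normc1_le_Dp].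
apply: (generatorsT (g := S)).
  split=> [|x y [C Cx] [C' Cy]|x [C Cx]].
  - by exists 0 => u k; rewrite invg1 mulg1 subrr [normc _]normc0 mul0r.
  - exists (C + C') => u k; rewrite invgM mulgA mulrDl.
    rewrite -[u (_ * x^-1)%g](subrK (u (k * y^-1)%g)) -addrA.
    by apply: le_trans (normcD _ _) _; rewrite lerD.
  - exists C => u k; have := Cx u (k * x)%g.
    by rewrite invgK mulgK -normcN opprB.
move=> s sS; exists 1 => u k; rewrite mul1r.
exact: (@normc_le_lpsum (translate s u - u) _ k
  (Dp_banach_norm_ge0 u) (lpsum_diff_le u sS)).
Qed.

Lemma normc_le_Dp_fset A : exists2 C : R, 0 < C &
  forall u g, g \in A -> normc (u g) <= C * N u.
Proof.
have [C Cu] := choice normc_le_Dp.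
exists (\sum_(g <- A) `|C g| + 1); first by rewrite ltr_wpDl// sumr_ge0.
move=> u g gA; apply: le_trans (Cu g u) _; rewrite ler_wpM2r ?Dp_banach_norm_ge0//.
apply: (le_trans (ler_norm _)); rewrite (big_rem g)//= -addrA lerDl.
by rewrite addr_ge0// sumr_ge0.
Qed.

Lemma closure_DpP K u :
  closure K u <-> forall e : R, 0 < e -> exists2 v, K v & N (v - u) < e.
Proof.
split=> [Ku e e0|Ku B /nbhs_ballP[e /= e0 eB]].
  have [|v [Kv]] := Ku (ball u e%:C); first by apply: nbhsx_ballx; rewrite ltcR.
  rewrite -ball_normE/= distrC => uv; exists v => //; by rewrite ltcR in uv.
(* A positive element of [R[i]] is real, so the radius can be compared with the real norm. *)
have eE : e = (complex.Re e)%:C.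
  by move: e0; case: (e) => a b; rewrite ltcE/= => /andP[/eqP-> _].
rewrite eE ltcR in e0; have [v Kv vu] := Ku _ e0.
exists v; split=> //; apply: eB; rewrite -ball_normE/= distrC eE.
by rewrite ltcR.
Qed.

(** Dominated convergence in D_p, behind all truncations and clampings below: [w] is fixed
    beforehand, [A] and [d] come next, and the approximant has only to be close to [u] on [A], with
    increments of the error controlled by a small [a] plus [w]. *)
Lemma closure_dominated K u (w : G -> G -> R[i]) :
  (forall s, s \in generators S -> (lpsum p (w s) < +oo)%E) ->
  (forall A (d : R), 0 < d -> exists2 v, K v &
    (forall g, g \in A -> normc (v g - u g) <= d) /\
    exists a : G -> G -> R[i], forall s, s \in generators S ->
      (lpsum p (a s) <= d%:E)%E /\
      forall g, normc ((v (g * s^-1)%g - u (g * s^-1)%g) - (v g - u g)) <=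
        normc (a s g) + normc (w s g)) ->
  closure K u.
Proof.
move=> wfin happrox; apply/closure_DpP => e e0.
(* Induction on the list of generators, since [lpsum_small] gives each one its own finite set and
   threshold. *)
have small (r : seq G) (e' : R) : {subset r <= generators S} -> 0 < e' ->
    exists A (d0 : R), 0 < d0 /\ forall (d : R) f (a : G -> G -> R[i]),
      0 < d -> d <= d0 -> (forall g, g \in A -> normc (f g) <= d) ->
      (forall s, s \in generators S -> (lpsum p (a s) <= d%:E)%E /\
        forall g, normc (f (g * s^-1)%g - f g) <= normc (a s g) + normc (w s g)) ->
    (\sum_(s <- r) lpsum p (translate s f - f)%R <= e'%:E)%E.
  elim: r e' => [|s r IH] e' rS e'0.
    exists fset0, 1; split=> // *; by rewrite big_nil lee_fin ltW.
  have e'2 : 0 < e' / 2 by rewrite divr_gt0.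
  have sS : s \in generators S by apply: rS; rewrite mem_head.
  have [|A1 [d1 [d10 H1]]] := IH _ _ e'2.
    by move=> t tr; apply: rS; rewrite inE tr orbT.
  have [A2 [d2 [d20 H2]]] := lpsum_small p0 (wfin _ sS) e'2.
  (* An increment at [g] also involves [g * s^-1], so the translated set is added; the increment is
     at most twice the pointwise error, whence [d2 / 2]. *)
  exists (A1 `|` (A2 `|` [fset (g * s^-1)%g | g in A2]))%fset, (Num.min d1 (d2 / 2)).
  rewrite lt_min d10 divr_gt0//; split=> // d f a d0; rewrite le_min.
  move=> /andP[dd1 dd2] fA fa; rewrite big_cons [e']splitr EFinD; apply: leeD.
    have [as1 as2] := fa _ sS.
    apply: (H2 (2 * d) _ (a s)) => //.
    + by rewrite mulrC -ler_pdivlMr.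
    + move=> g gA; rewrite mulr_natl mulr2n; apply: le_trans (normcD _ _) _.
      rewrite normcN; apply: lerD; apply: fA; rewrite !in_fsetU ?gA ?orbT//.
      by apply/orP; right; apply/orP; right; apply/imfsetP; exists g.
    + apply: le_trans as1 _; rewrite lee_fin; lra.
  apply: (H1 d f a) => // g gA; apply: fA; by rewrite in_fsetU gA.
have e30 : 0 < e `^ p / 3 by rewrite divr_gt0// powR_gt0.
have [A [d0 [d00 H]]] := small (generators S) _ (fun _ => id) e30.
pose d1 := (e `^ p / 3) `^ p^-1.
have d10 : 0 < d1 by rewrite powR_gt0.
(* The point [1%g] is added because the Banach norm contains the value there. *)
have [|v Kv [vA [a av]]] := happrox (1%g |` A)%fset (Num.min d0 d1).
  by rewrite lt_min d00.
exists v => //; apply: Dp_banach_norm_lt => //.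
apply: (@le_lt_trans _ _ (e `^ p / 3 + e `^ p / 3)); last first.
  have := powR_gt0 p e0; lra.
apply: lerD.
  rewrite -lee_fin fineK; last exact: Dp_energy_fin (Dp_funP (v - u)).
  rewrite Dp_energyE; apply: (H (Num.min d0 d1) _ a) => //.
  - by rewrite lt_min d00.
  - by rewrite ge_min lexx.
  - by move=> g gA; apply: vA; rewrite in_fsetU gA orbT.
have -> : e `^ p / 3 = d1 `^ p by rewrite /d1 -powRrM mulVf// powRr1// ltW.
apply: ge0_ler_powR; rewrite ?nnegrE ?normc_ge0 ?(ltW p0) ?(ltW d10)//.
apply: le_trans (vA _ _) _; first by rewrite in_fsetU in_fset1 eqxx.
by rewrite ge_min lexx orbT.
Qed.

Lemma lpsum_indicator A : lpsum p (fun g => (g \in A)%:R) = (#|` A|%:R : R)%:E.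
Proof.
rewrite /lpsum (esumID [set` A])//; last by move=> g _; rewrite lee_fin powR_ge0.
rewrite !setTI [X in (_ + X)%E]esum1; last first.
  by move=> g /= /negP/negbTE ->; rewrite [normc _]normc0 powR0.
rewrite adde0 esum_fset//; last by move=> g _; rewrite lee_fin powR_ge0.
rewrite fsbig_finite//= set_fsetK big_seq.
rewrite (eq_bigr (fun => 1%E)); last first.
  by move=> g ->; rewrite [normc _]normc1 powR1.
by rewrite -big_seq sumEFin big_const_seq count_predT iter_addr_0.
Qed.

Lemma in_Dp_indicator A : in_Dp S p (fun g => (g \in A)%:R).
Proof. by apply: in_Dp_lpsum; rewrite lpsum_indicator ltry. Qed.

Definition indicator A : D := mkDp (in_Dp_indicator A).

End Dp_closure.

Section Dp_approximation.
Context {R : realType} {G : groupType} {p : R}.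
Variables (S : generating_set G) (p1 : 1 < p).
Local Notation D := (Dp S p1).
Local Notation BD := (BDp S p1).
Local Notation N := (Dp_banach_norm S p).
Local Notation fs := (finitely_supported S p1).
Implicit Types (f : G -> R[i]) (u v z : D) (K : set D) (A : {fset G}).

Let p0 : 0 < p. Proof. by rewrite (lt_trans ltr01). Qed.
Let pN0 : p != 0. Proof. by rewrite gt_eqF. Qed.

Lemma finitely_supported0 : fs 0.
Proof.
rewrite /finitely_supported/= (_ : [set _ | _] = set0) ?finite_set0//.
by apply/seteqP; split=> g //=; rewrite eqxx.
Qed.

Lemma finitely_supportedD u v : fs u -> fs v -> fs (u + v).
Proof.
move=> fu fv; apply: (@sub_finite_set _ _ ([set g | u g != 0] `|` [set g | v g != 0])).
  move=> g uvg; have [ug0|] := eqVneq (u g) 0; last by left.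
  have [vg0|] := eqVneq (v g) 0; last by right.
  have /eqP[] : (u + v) g != 0 by [].
  by rewrite -[LHS]/(u g + v g) ug0 vg0 addr0.
by rewrite finite_setU.
Qed.

Lemma finitely_supportedZ (c : R[i]) u : fs u -> fs (c *: u).
Proof.
apply: sub_finite_set => g cug; apply/eqP => ug0.
have /eqP[] : (c *: u) g != 0 by [].
by rewrite -[LHS]/(c * u g) ug0 mulr0.
Qed.

Lemma finitely_supported_fset u A : (forall g, g \notin A -> u g = 0) -> fs u.
Proof.
move=> uA; apply: (@sub_finite_set _ _ [set` A]) => //= g.
by apply: contraR => /uA ->.
Qed.

Lemma closure_finitely_supportedD u v :
  closure fs u -> closure fs v -> closure fs (u + v).
Proof.
move=> /closure_DpP fu /closure_DpP fv; apply/closure_DpP => e e0.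
have e20 : 0 < e / 2 by rewrite divr_gt0.
have [u' fu' u'e] := fu _ e20; have [v' fv' v'e] := fv _ e20.
exists (u' + v'); first exact: finitely_supportedD.
rewrite opprD addrACA (splitr e); apply: le_lt_trans (Dp_banach_normD _ _) _.
exact: ltrD u'e v'e.
Qed.

Lemma closure_closure_fs u : closure (closure fs) u -> closure fs u.
Proof.
move=> cu; suff <- : closure (closure fs) = closure fs by [].
by rewrite -(closure_id _).1//; exact: closed_closure.
Qed.

(** Restrict [u] to finite sets: the error is at most [u] in modulus, so its increments are
    dominated by [u] and a translate. *)
Lemma lpsum_closure_fs u : (lpsum p u < +oo)%E -> closure fs u.
Proof.
move=> ufin.
apply: (@closure_dominated _ _ _ _ _ _ _
  (fun s g => (1 * normc (translate s u g) + 1 * normc (u g))%:C)).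
  by move=> s sS; apply: lpsum_finDreal => //; rewrite lpsum_translate.
move=> A d d0; pose f g := if g \in A then u g else 0.
have ffin : (lpsum p f < +oo)%E.
  apply: le_lt_trans ufin; apply: le_lpsum (ltW p0) _ => g; rewrite /f.
  by case: ifP => // _; rewrite [normc 0]normc0 normc_ge0.
have Df : in_Dp S p f by exact: in_Dp_lpsum.
exists (mkDp p1 Df).
  by apply: (@finitely_supported_fset _ A) => g /negbTE gA; rewrite /= /f gA.
split=> [g gA|]; first by rewrite /= /f gA subrr [normc _]normc0 ltW.
exists (fun _ _ => 0) => s sS; split.
  by rewrite [X in (X <= _)%E](lpsum0 p1) lee_fin ltW.
move=> g; rewrite [normc 0]normc0 add0r normc_real ger0_norm; last first.
  by rewrite !mul1r addr_ge0 ?normc_ge0.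
have fle g' : normc (f g' - u g') <= normc (u g').
  rewrite /f; case: ifP => _; first by rewrite subrr [normc 0]normc0 normc_ge0.
  by rewrite sub0r normcN.
rewrite !mul1r; apply: le_trans (normcD _ _) _; rewrite normcN.
by apply: lerD; exact: fle.
Qed.

Lemma in_Dp_clampC (M : R) u : in_Dp S p (fun g => clampC M (u g)).
Proof.
apply: (@in_Dp_dominated _ _ _ _ p1 _ (fun s => translate s u - u)).
  by move=> s sS; exact: (in_DpE S _).1 (Dp_funP u) s sS.
by move=> s g sS; exact: clampC_lip.
Qed.

Lemma closure_bounded u :
  closure [set v : D | exists M : R, forall g, normc (v g) <= M] u.
Proof.
apply: (@closure_dominated _ _ _ _ _ _ _ (fun s => (2 : R)%:C *: (translate s u - u))).
  by move=> s sS; apply: lpsum_finZ; exact: (in_DpE S _).1 (Dp_funP u) s sS.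
(* [M] is at least every modulus of [u] on [A], so clamping at [M] does not change [u] there. *)
move=> A d d0; pose M := \sum_(g <- A) normc (u g).
have M0 : 0 <= M by apply: sumr_ge0 => g _; exact: normc_ge0.
exists (mkDp p1 (in_Dp_clampC M u)).
  by exists (2 * M) => g; exact: clampC_bound.
split=> [g gA|].
  rewrite /= clampC_id ?subrr ?[normc 0]normc0 ?(ltW d0)//.
  rewrite /M (big_rem g)//= lerDl; apply: sumr_ge0 => g' _; exact: normc_ge0.
exists (fun _ _ => 0) => s sS; split.
  by rewrite [X in (X <= _)%E](lpsum0 p1) lee_fin ltW.
move=> g; rewrite [normc 0]normc0 add0r normcM normc_real ger0_norm// mulr_natl mulr2n /=.
rewrite [X in normc X](_ : _ = (clampC M (u (g * s^-1)%g) - clampC M (u g)) -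
  (u (g * s^-1)%g - u g)); last by ring.
apply: le_trans (normcD _ _) _; rewrite normcN.
by apply: lerD => //; exact: clampC_lip.
Qed.

(** The error of the soft threshold is the clamped [u], which is uniformly small and has increments
    at most those of [u]. *)
Lemma closure_clampC K u :
  (forall e : R, 0 < e -> exists2 v, K v & forall g, v g = u g - clampC e (u g)) ->
  closure K u.
Proof.
move=> hK.
apply: (@closure_dominated _ _ _ _ _ _ _ (fun s => translate s u - u)).
  by move=> s sS; exact: (in_DpE S _).1 (Dp_funP u) s sS.
move=> A d d0; have [|v Kv vE] := hK (d / 2); first by rewrite divr_gt0.
exists v => //; split=> [g gA|].
  rewrite vE addrAC subrr sub0r normcN.
  apply: le_trans (clampC_bound _ _) _; first by rewrite divr_ge0// ltW.
  by rewrite mulrC divfK.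
exists (fun _ _ => 0) => s sS; split.
  by rewrite [X in (X <= _)%E](lpsum0 p1) lee_fin ltW.
move=> g; rewrite [normc 0]normc0 add0r !vE.
rewrite (addrAC (u _)) subrr sub0r (addrAC (u g)) subrr sub0r opprK addrC.
rewrite -[normc _]normcN opprB [leRHS](_ : _ = normc (u (g * s^-1)%g - u g))//.
exact: clampC_lip.
Qed.

(** There is no uniform bound on the approximants [u'] of [u], so [u'] times the increments of [h]
    would not be dominated. Clamping [u'] at [M] cures this and leaves [u] itself fixed. *)
Lemma closure_finitely_supportedM u v (M : R) (h : G -> R[i]) (C : R) :
  closure fs u -> (forall g, normc (u g) <= M) ->
  in_Dp S p h -> (forall g, normc (h g) <= C) ->
  (forall g, v g = u g * h g) -> closure fs v.
Proof.
move=> /closure_DpP cu uM Dh hC vE.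
have M0 : 0 <= M by apply: le_trans (uM 1%g); exact: normc_ge0.
have C0 : 0 <= C by apply: le_trans (hC 1%g); exact: normc_ge0.
apply: (@closure_dominated _ _ _ _ _ _ _ (fun s g =>
   (2 * C * normc ((translate s u - u) g) +
    4 * M * normc ((translate s h - h) g))%:C)).
  move=> s sS; apply: lpsum_finDreal => //; last exact: (in_DpE S _).1 Dh s sS.
  exact: (in_DpE S _).1 (Dp_funP u) s sS.
move=> A d d0.
have [B B0 uB] := normc_le_Dp_fset S p1 A.
(* The first bound makes the error on [A] at most [d]; the second makes the [p]-sum of [C] times the
   increments of [u' - u] at most [d]. Writing [C + 1] avoids a division by 0. *)
pose e := Num.min (d / (B * (C + 1))) (d `^ p^-1 / (C + 1)).
have C10 : 0 < C + 1 by rewrite ltr_wpDl.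
have e0 : 0 < e by rewrite lt_min !divr_gt0 ?mulr_gt0 ?powR_gt0.
have [u' fu' u'e] := cu _ e0.
pose c g := clampC M (u' g).
pose w g := c g * h g.
have cu'1 g : normc (c g - u g) <= normc (u' g - u g).
  by rewrite -{1}(clampC_id (uM g)); exact: clampC_lip.
have cu'2 g : normc (c g - u g) <= 4 * M.
  apply: le_trans (normcD _ _) _; rewrite normcN.
  have := clampC_bound (u' g) M0; have := uM g; rewrite -/(c g); lra.
have wE g : w g - v g = (c g - u g) * h g by rewrite vE /w mulrBl.
(* Discrete Leibniz rule for [(c - u) * h]. *)
have diff s g : normc ((w (g * s^-1)%g - v (g * s^-1)%g) - (w g - v g)) <=
    C * normc ((c (g * s^-1)%g - c g) - (u (g * s^-1)%g - u g)) +
    4 * M * normc (h (g * s^-1)%g - h g).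
  rewrite !wE [X in normc X](_ : _ =
    ((c (g * s^-1)%g - c g) - (u (g * s^-1)%g - u g)) * h (g * s^-1)%g +
    (c g - u g) * (h (g * s^-1)%g - h g)); last by ring.
  apply: le_trans (normcD _ _) _; rewrite !normcM; apply: lerD.
    by rewrite mulrC ler_wpM2r ?normc_ge0.
  by rewrite ler_wpM2r ?normc_ge0.
have diffc s g : normc ((c (g * s^-1)%g - c g) - (u (g * s^-1)%g - u g)) <=
    normc ((u' (g * s^-1)%g - u (g * s^-1)%g) - (u' g - u g)) +
    2 * normc (u (g * s^-1)%g - u g).
  apply: le_trans (normcD _ _) _; rewrite normcN mulr_natl mulr2n addrA lerD2r.
  apply: (le_trans (clampC_lip _ _ _)).
  rewrite [X in normc X](_ : _ = ((u' (g * s^-1)%g - u (g * s^-1)%g) - (u' g - u g)) +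
     (u (g * s^-1)%g - u g)); last by ring.
  exact: normcD.
have Dw : in_Dp S p w.
  apply: (@in_Dp_dominated _ _ _ _ p1 _ (fun s g =>
   (C * normc ((translate s u' - u') g) +
    2 * M * normc ((translate s h - h) g))%:C)).
    move=> s sS; apply: lpsum_finDreal => //; last exact: (in_DpE S _).1 Dh s sS.
    exact: (in_DpE S _).1 (Dp_funP u') s sS.
  move=> s g sS; rewrite normc_real ger0_norm; last first.
    by rewrite addr_ge0// !mulr_ge0// normc_ge0.
  rewrite /w [X in normc X](_ : _ = (c (g * s^-1)%g - c g) * h (g * s^-1)%g +
    c g * (h (g * s^-1)%g - h g)); last by ring.
  apply: le_trans (normcD _ _) _; rewrite !normcM; apply: lerD.
    rewrite mulrC; apply: ler_pM; rewrite ?normc_ge0//; exact: clampC_lip.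
  by rewrite ler_wpM2r ?normc_ge0//; exact: clampC_bound.
exists (mkDp p1 Dw).
  apply: sub_finite_set fu' => g /=; apply: contra => /eqP u'g0.
  by rewrite /w /c u'g0 clampC_id ?mul0r// [normc _]normc0.
split=> [g gA|].
  rewrite [mkDp _ _ g]/(w g) wE normcM.
  apply: (@le_trans _ _ ((B * e) * (C + 1))).
    apply: ler_pM; rewrite ?normc_ge0//; last by rewrite (le_trans (hC g))// lerDl.
    apply: le_trans (cu'1 g) _; apply: (le_trans (uB (u' - u) g gA)).
    by rewrite ler_wpM2l// ltW.
  rewrite mulrAC -ler_pdivlMl ?mulr_gt0// mulrC.
  by rewrite /e ge_min lexx.
(* Only the increments of [u' - u] are small; those of [u] and [h] go into the dominating
   function. *)
exists (fun s => C%:C *: (translate s (u' - u : D) - (u' - u : D))) => s sS; split.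
  rewrite lpsumZ normc_real ger0_norm//.
  apply: (@le_trans _ _ ((C `^ p)%:E * (e `^ p)%:E)%E).
    apply: lee_wpmul2l; first by rewrite lee_fin powR_ge0.
    apply: (le_trans (lpsum_diff_le (u' - u) sS)); rewrite lee_fin.
    apply: ge0_ler_powR; rewrite ?nnegrE ?Dp_banach_norm_ge0 ?(ltW p0) ?(ltW e0)//.
    exact: ltW.
  rewrite -EFinM -powRM ?(ltW e0)// lee_fin.
  have dE : d = (d `^ p^-1) `^ p by rewrite -powRrM mulVf// powRr1// ltW.
  rewrite [leRHS]dE.
  apply: ge0_ler_powR; rewrite ?nnegrE ?powR_ge0 ?(ltW p0)//.
    by rewrite mulr_ge0// ltW.
  apply: (@le_trans _ _ ((C + 1) * e)); first by rewrite ler_wpM2r ?lerDl// ltW.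
  by rewrite mulrC -ler_pdivlMr// /e ge_min lexx orbT.
move=> g; rewrite [mkDp _ _ _]/(w _) [mkDp _ _ g]/(w g).
apply: (le_trans (diff s g)).
rewrite normcM !normc_real ger0_norm// [X in _ <= _ + X]ger0_norm; last first.
  by rewrite addr_ge0// !mulr_ge0// normc_ge0.
rewrite addrA lerD2r (mulrC 2) -mulrA -mulrDr ler_wpM2l//.
Qed.

End Dp_approximation.

(** * Points of the p-harmonic boundary *)

(** Compactness of the segment gives a cluster point, and a cluster point of an ultrafilter is a
    limit. *)
Lemma ultrafilter_cvg_bounded (R : realType) (T : Type) (U : set_system T)
    (r : T -> R) (M : R) :
  UltraFilter U -> (forall x, `|r x| <= M) -> exists l : R, r x @[x --> U] --> l.
Proof.
move=> UU rM; have rU : (r x @[x --> U]) `[- M, M]%classic.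
  apply: (@filterS _ U _ setT) => [x _|]; last exact: filterT.
  by rewrite /= in_itv/= -ler_norml.
have [l [_ lr]] := @segment_compact R (- M) M _ _ rU.
exists l => B Bl; have [//|UB] := in_ultra_setVsetC (r @^-1` B) UU.
have [y [yB By]] : ~` B `&` B !=set0.
  by apply: lr => //; apply: filterS UB => x.
by [].
Qed.

Section boundary_points.
Context {R : realType} {G : groupType} {p : R}.
Variables (S : generating_set G) (p1 : 1 < p).
Local Notation D := (Dp S p1).
Local Notation BD := (BDp S p1).
Local Notation fs := (finitely_supported S p1).
Local Notation I := (B_closure S p1).
Implicit Types (u v h : BD) (d e : R).

Let p0 : 0 < p. Proof. by rewrite (lt_trans ltr01). Qed.

Definition mkBDp (f : G -> R[i])
    (Bf : in_Dp S p f /\ exists M : R, forall g, normc (f g) <= M) : BD :=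
  MkBDp (asboolT Bf : f \in BDp_pred S p1).

Lemma BDp_in_Dp u : in_Dp S p u.
Proof. by case: u => f /= /asboolP[]. Qed.

Lemma BDp_bounded u : exists2 M : R, 0 <= M & forall g, normc (u g) <= M.
Proof.
case: u => f /= /asboolP[_ [M fM]]; exists M => //.
exact: le_trans (normc_ge0 _) (fM 1%g).
Qed.

(** Functional calculus by Lipschitz functions. The bounds are asked only on the values of [u], so
    that its boundedness may be used. *)
Lemma BDp_lipschitz (F : R[i] -> R[i]) (C : R) u :
  (forall x y, normc (F (u x) - F (u y)) <= C * normc (u x - u y)) ->
  (exists M : R, forall g, normc (F (u g)) <= M) ->
  exists v, forall g, v g = F (u g).
Proof.
move=> FL FM; suff DF : in_Dp S p (F \o u) by exists (mkBDp (conj DF FM)).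
have Du := BDp_in_Dp u.
apply: (@in_Dp_dominated _ _ _ _ p1 _ (fun s => `|C|%:C *: (translate s u - u))).
  by move=> s sS; apply: lpsum_finZ; exact: (in_DpE S _).1 Du s sS.
move=> s g sS; rewrite normcM normc_real normr_id.
by apply: le_trans (FL _ _) _; rewrite ler_wpM2r ?normc_ge0// ler_norm.
Qed.

Lemma B_closureM u h : I u -> I (u * h).
Proof.
have [M _ uM] := BDp_bounded u; have [C _ hC] := BDp_bounded h => Iu.
apply: (@closure_finitely_supportedM _ _ _ _ _ (BDp_inclusion u) _ M h C) => //.
exact: BDp_in_Dp.
Qed.

Lemma B_closureD u v : I u -> I v -> I (u + v).
Proof.
move=> Iu Iv; rewrite /B_closure/=.
rewrite (_ : BDp_inclusion _ = BDp_inclusion u + BDp_inclusion v).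
  exact: closure_finitely_supportedD.
exact: val_inj.
Qed.

Lemma normc_conjc (z : R[i]) : normc z^* = normc z.
Proof. by case: z => a b /=; rewrite sqrrN. Qed.

Lemma mulr_conjc (z : R[i]) : z * z^* = (normc z ^+ 2)%:C.
Proof.
case: z => a b; rewrite [normc _]/= sqr_sqrtr ?addr_ge0 ?sqr_ge0//.
by apply/eqP; rewrite eq_complex/=; apply/andP; split; apply/eqP; ring.
Qed.

Lemma BDp_conjc u : exists v, forall g, v g = (u g)^*.
Proof.
apply: (@BDp_lipschitz (fun z => z^*) 1).
  by move=> x y; rewrite mul1r -rmorphB normc_conjc.
by have [M _ uM] := BDp_bounded u; exists M => g; rewrite normc_conjc.
Qed.

Lemma B_closure_sqr u : I u -> exists2 v, I v & forall g, v g = (normc (u g) ^+ 2)%:C.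
Proof.
move=> Iu; have [v vE] := BDp_conjc u; exists (u * v); first exact: B_closureM.
by move=> g; rewrite -[LHS]/(u g * v g) vE mulr_conjc.
Qed.

(** The sum of the squared moduli of [u] and [v] is again in the ideal and is small only where both
    are small. Hence the sets where elements of the ideal are small form a filter base. *)
Lemma B_closure_small u v d e : I u -> I v -> 0 < d -> 0 < e ->
  exists w c, [/\ I w, 0 < c &
    forall g, normc (w g) < c -> normc (u g) < d /\ normc (v g) < e].
Proof.
move=> Iu Iv d0 e0; have [u2 Iu2 u2E] := B_closure_sqr Iu.
have [v2 Iv2 v2E] := B_closure_sqr Iv.
exists (u2 + v2), (Num.min (d ^+ 2) (e ^+ 2)).
split; first exact: B_closureD.
  by rewrite lt_min !exprn_gt0.
move=> g; have -> : (u2 + v2) g = (normc (u g) ^+ 2 + normc (v g) ^+ 2)%:C.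
  by rewrite rmorphD/= -u2E -v2E.
rewrite normc_real ger0_norm ?addr_ge0 ?sqr_ge0// lt_min => /andP[ud ve].
split; rewrite -ltr_sqr ?nnegrE ?normc_ge0 ?(ltW d0) ?(ltW e0)//.
  by apply: le_lt_trans ud; rewrite lerDl sqr_ge0.
by apply: le_lt_trans ve; rewrite lerDr sqr_ge0.
Qed.

(** This inverts the squared modulus of [u] where it is at least [d]; the cut-off at [d] keeps the
    inverse bounded and Lipschitz. *)
Lemma BDp_inv_max u d : 0 < d ->
  exists v, forall g, v g = (Num.max (normc (u g) ^+ 2) d)^-1%:C.
Proof.
move=> d0; have [M M0 uM] := BDp_bounded u.
pose m g := Num.max (normc (u g) ^+ 2) d.
have md g : d <= m g by rewrite /m le_max lexx orbT.
have m0 g : 0 < m g by exact: lt_le_trans (md g).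
(* The difference of the squared moduli is at most [2 * M] times [normc (u x - u y)], and each of
   the two denominators is at least [d]. *)
apply: (@BDp_lipschitz (fun z => (Num.max (normc z ^+ 2) d)^-1%:C) (2 * M / d ^+ 2)).
  move=> x y; rewrite -rmorphB normc_real -/(m x) -/(m y).
  have -> : (m x)^-1 - (m y)^-1 = (m y - m x) * (m x * m y)^-1.
    by field; rewrite !gt_eqF.
  rewrite normrM [X in _ * X]ger0_norm ?invr_ge0 ?mulr_ge0 ?(ltW (m0 _))//.
  rewrite mulrAC; apply: ler_pM => //.
    by rewrite invr_ge0 mulr_ge0 ?(ltW (m0 _)).
  - apply: (@le_trans _ _ `|normc (u x) ^+ 2 - normc (u y) ^+ 2|).
      rewrite distrC /m /Num.max; set a := normc (u x) ^+ 2; set b := normc (u y) ^+ 2.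
      rewrite ler_norml; have := ler_norm (a - b); have := ler_norm (b - a).
      rewrite (distrC b); case: (ltP a d) => ?; case: (ltP b d) => ?; move=> ? ?;
      apply/andP; split; lra.
    rewrite subr_sqr normrM mulrC; apply: ler_pM => //.
      rewrite ger0_norm ?addr_ge0 ?normc_ge0// mulr_natl mulr2n; exact: lerD.
    have tri (a b : R[i]) : normc a - normc b <= normc (a - b).
      by rewrite lerBlDr -{1}(subrK b a); exact: normcD.
    rewrite ler_norml tri andbT lerNl opprB -[normc (_ - _)]normcN opprB; exact: tri.
  - rewrite lef_pV2 ?posrE ?mulr_gt0 ?exprn_gt0// expr2.
    by rewrite ler_pM ?md ?(ltW d0).
exists d^-1 => g; rewrite -/(m g) normc_real ger0_norm ?invr_ge0 ?(ltW (m0 g))//.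
by rewrite lef_pV2 ?posrE.
Qed.

Lemma BDp_soft h e : 0 <= e -> exists v, forall g, v g = h g - clampC e (h g).
Proof.
move=> e0; have [M M0 hM] := BDp_bounded h.
apply: (@BDp_lipschitz (fun z => z - clampC e z) 2).
  move=> x y; rewrite [X in normc X](_ : _ =
    (h x - h y) - (clampC e (h x) - clampC e (h y))); last by ring.
  apply: le_trans (normcD _ _) _; rewrite normcN mulr_natl mulr2n.
  by apply: lerD => //; exact: clampC_lip.
exists (M + 2 * e) => g; apply: le_trans (normcD _ _) _; rewrite normcN.
by apply: lerD; [exact: hM|exact: clampC_bound].
Qed.

(* If the values of [u] in [I] stay away from [0] where [h] is large, then the
   soft threshold of [h] is divisible by [u], hence belongs to the ideal [I]. *)
Lemma B_closure_separation h : ~ I h -> exists2 e, 0 < e &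
  forall u d, I u -> 0 < d -> exists g, normc (u g) < d /\ e <= normc (h g).
Proof.
apply: contra_notP => hsep; apply/closure_closure_fs/closure_clampC => e e0.
have [u [d [Iu d0 ud]]] : exists u d, [/\ I u, 0 < d &
    forall g, e <= normc (h g) -> d <= normc (u g)].
  apply: contra_notP hsep => hn; exists e => // u d Iu d0.
  apply: contra_notP hn => hn; exists u, d; split=> // g eg.
  by rewrite leNgt; apply/negP => ug; apply: hn; exists g.
have [he heE] := BDp_soft h (ltW e0); have [c cE] := BDp_conjc u.
have d20 : 0 < d ^+ 2 by rewrite exprn_gt0.
have [m mE] := BDp_inv_max u d20.
(* The product is [he] times the quotient of the squared modulus of [u] by its maximum with
   [d ^+ 2]. That quotient is 1 where [h] has modulus at least [e], and [he] is 0 elsewhere. *)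
exists (BDp_inclusion (u * (c * (m * he)))); first exact: B_closureM.
move=> g; rewrite -[LHS]/(u g * (c g * (m g * he g))) cE mE heE mulrA mulr_conjc.
have [hge|/ltW hge] := leP e (normc (h g)); last first.
  by rewrite clampC_id// subrr !mulr0.
have ug : d ^+ 2 <= normc (u g) ^+ 2.
  by rewrite ler_sqr ?nnegrE ?normc_ge0 ?ud// ltW.
rewrite (max_idPl ug) mulrA -rmorphM mulfV ?mul1r//.
by rewrite gt_eqF// (lt_le_trans d20).
Qed.

(** Real and imaginary parts of [h] are bounded, so they converge along [U]; [tau h] is the limit,
    and limits respect sums and products. *)
Lemma ultrafilter_character (U : set_system G) : UltraFilter U ->
  exists tau, [/\ Sp S p1 tau,
    forall u, (forall d, 0 < d -> U [set g | normc (u g) < d]) -> tau u = 0 &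
    forall h e, 0 < e -> U [set g | e <= normc (h g)] -> tau h != 0].
Proof.
move=> UU.
have cvgRe h : exists l : R, Re (h g) @[g --> U] --> l.
  have [M _ hM] := BDp_bounded h; apply: (@ultrafilter_cvg_bounded _ _ _ _ M) => g.
  exact: le_trans (Re_le_normc _) (hM g).
have cvgIm h : exists l : R, Im (h g) @[g --> U] --> l.
  have [M _ hM] := BDp_bounded h; apply: (@ultrafilter_cvg_bounded _ _ _ _ M) => g.
  exact: le_trans (Im_le_normc _) (hM g).
have [a ha] := choice cvgRe; have [b hb] := choice cvgIm.
pose tau h := a h +i* b h.
(* By uniqueness of limits, each algebraic law reduces to the convergence of real and imaginary
   parts. *)
have tauE h (x y : R) : Re (h g) @[g --> U] --> x -> Im (h g) @[g --> U] --> y ->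
    tau h = x +i* y.
  move=> hx hy; congr (_ +i* _).
    exact: cvg_unique (ha h) hx.
  exact: cvg_unique (hb h) hy.
exists tau; split.
- split.
  + move=> [x y] u v.
    rewrite (@tauE _ (x * a u - y * b u + a v) (x * b u + y * a u + b v)).
    * rewrite /tau; apply/eqP; rewrite eq_complex/=.
      by apply/andP; split; apply/eqP; ring.
    * rewrite (_ : (fun g => _) = fun g => x * Re (u g) - y * Im (u g) + Re (v g)).
        apply: cvgD => //; apply: cvgB; apply: cvgMr => //.
      apply/funext => g.
      by rewrite -[X in Re X]/((x +i* y) * u g + v g); case: (u g) (v g) => [? ?] [? ?].
    * rewrite (_ : (fun g => _) = fun g => x * Im (u g) + y * Re (u g) + Im (v g)).
        apply: cvgD => //; apply: cvgD; apply: cvgMr => //.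
      apply/funext => g.
      by rewrite -[X in Im X]/((x +i* y) * u g + v g); case: (u g) (v g) => [? ?] [? ?].
  + move=> u v.
    rewrite (@tauE _ (a u * a v - b u * b v) (a u * b v + b u * a v)).
    * by rewrite /tau; apply/eqP; rewrite eq_complex/= !eqxx.
    * rewrite (_ : (fun g => _) = fun g => Re (u g) * Re (v g) - Im (u g) * Im (v g)).
        by apply: cvgB; apply: cvgM.
      apply/funext => g.
      by rewrite -[X in Re X]/(u g * v g); case: (u g) (v g) => [? ?] [? ?].
    * rewrite (_ : (fun g => _) = fun g => Re (u g) * Im (v g) + Im (u g) * Re (v g)).
        by apply: cvgD; apply: cvgM.
      apply/funext => g.
      by rewrite -[X in Im X]/(u g * v g); case: (u g) (v g) => [? ?] [? ?].
  + exists 1; rewrite (@tauE _ 1 0); first by rewrite eq_complex/= oner_eq0.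
      exact: cvg_cst.
    exact: cvg_cst.
- move=> u Uu; rewrite (@tauE _ 0 0)//.
    apply/cvgrPdist_lt => d d0; apply: filterS (Uu d d0) => g /=.
    by rewrite sub0r normrN; apply: le_lt_trans; exact: Re_le_normc.
  apply/cvgrPdist_lt => d d0; apply: filterS (Uu d d0) => g /=.
  by rewrite sub0r normrN; apply: le_lt_trans; exact: Im_le_normc.
- move=> h e e0 Uh; apply/eqP => tauh.
  have [ah bh] : a h = 0 /\ b h = 0 by move: tauh => [].
  have e20 : 0 < e / 2 by rewrite divr_gt0.
  have := ha h; rewrite ah => /cvgrPdist_lt /(_ _ e20) URe.
  have := hb h; rewrite bh => /cvgrPdist_lt /(_ _ e20) UIm.
  have [g [[/= eg Reg] Img]] := @filter_ex _ U _ _ (filterI (filterI Uh URe) UIm).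
  move: Reg Img; rewrite !sub0r !normrN => Reg Img.
  have : normc (h g) <= `|Re (h g)| + `|Im (h g)|.
    rewrite [X in normc X](complexE (h g)); apply: le_trans (normcD _ _) _.
    rewrite normcM !normc_real.
    by rewrite [normc 'i]/= expr0n add0r expr1n sqrtr1 mul1r.
  lra.
Qed.

Lemma boundary_point h : ~ I h -> exists2 tau, p_harmonic_boundary S p1 tau & tau h != 0.
Proof.
move=> /B_closure_separation[e e0 hsep].
pose P := [set ud : BD * R | I ud.1 /\ 0 < ud.2].
pose B (ud : BD * R) := [set g : G | normc (ud.1 g) < ud.2 /\ e <= normc (h g)].
have I0 : I 0.
  apply: subset_closure; rewrite (_ : BDp_inclusion 0 = 0); last exact: val_inj.
  exact: finitely_supported0.
have FF : ProperFilter (filter_from P B).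
  apply: filter_from_proper; last by move=> [u d] [/= Iu d0]; exact: hsep.
  apply: filter_from_filter; first by exists (0, 1).
  move=> [u d] [v c] [/= Iu d0] [/= Iv c0].
  have [w [r [Iw r0 wr]]] := B_closure_small Iu Iv d0 c0.
  exists (w, r); first by [].
  by move=> g [/= /wr[ud vc] eh].
have [U [UU FU]] := ultraFilterLemma FF.
have [tau [Sptau tau0 tauh]] := ultrafilter_character UU.
have tauI u : I u -> tau u = 0.
  move=> Iu; apply: tau0 => d d0; apply: FU; exists (u, d); first by [].
  by move=> g [].
exists tau; last first.
  apply: (tauh h e e0); apply: FU; exists (0, 1); first by [].
  by move=> g [].
split; last exact: tauI.
split=> // -[g _ taug].
(* The character is not the evaluation at [g]: the point mass at [g] lies in the ideal but has the
   value 1 at [g]. *)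
pose dg : G -> R[i] := indicator S p1 [fset g]%fset.
have Bdg : exists M : R, forall k, normc (dg k) <= M.
  exists 1 => k; rewrite /dg/=; case: (k \in _); first by rewrite [normc _]normc1.
  by rewrite [normc _]normc0.
pose dd := mkBDp (conj (Dp_funP _) Bdg).
have Idd : I dd by apply: lpsum_closure_fs; rewrite (lpsum_indicator p1) ltry.
have := tauI _ Idd; rewrite -taug /evaluation /= in_fset1 eqxx => /eqP.
by rewrite oner_eq0.
Qed.

End boundary_points.

(** * Functionals *)

Section functionals.
Context {R : realType} {G : groupType} {p : R}.
Variables (S : generating_set G) (p1 : 1 < p).
Local Notation D := (Dp S p1).
Local Notation BD := (BDp S p1).
Local Notation Q := (DpC S p1).
Local Notation N := (Dp_banach_norm S p).
Local Notation fs := (finitely_supported S p1).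
Local Notation I := (B_closure S p1).
Local Notation class := (@DpC_class R G p S p1).
Local Notation ind := (indicator S p1).
Implicit Types (u v : D) (A : {fset G}) (T : {linear Q -> R[i]^o}).

Let p0 : 0 < p. Proof. by rewrite (lt_trans ltr01). Qed.
Let pN0 : p != 0. Proof. by rewrite gt_eqF. Qed.

Lemma DpC_classZ (c : R[i]) u : class (c *: u) = c *: class u.
Proof. by rewrite -DpC_scale_class. Qed.

Lemma DpC_class_sum (J : Type) (r : seq J) (F : J -> D) :
  class (\sum_(i <- r) F i) = \sum_(i <- r) class (F i).
Proof.
apply: (big_morph class (@DpC_classD R G p S p1)).
by rewrite /DpC_class raddf0.
Qed.

Lemma linear_continuous_bound T : continuous T ->
  exists2 C : R, 0 < C & forall u, normc (T (class u) : R[i]) <= C * Dp_seminorm S p u.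
Proof.
move=> Tcont.
have /linear_boundedP/pinfty_ex_gt0[C C0 TC] := continuous_linear_bounded 0 (Tcont 0).
have CE : C = (Re C)%:C.
  by move: C0; case: (C) => a b; rewrite ltcE/= => /andP[/eqP-> _].
exists (Re C); first by rewrite CE ltcR in C0.
move=> u; have := TC (class u).
rewrite [X in X * _]CE -[X in _ * X]/((DpC_norm (class u))%:C) DpC_norm_class.
by rewrite -rmorphM lecR.
Qed.

Lemma bounded_linear_closure (F : D -> R[i]) (C : R) (K : set D) u :
  0 <= C -> (forall v w, F (v - w) = F v - F w) -> (forall v, normc (F v) <= C * N v) ->
  (forall v, K v -> F v = 0) -> closure K u -> F u = 0.
Proof.
move=> C0 FB FC FK /closure_DpP Ku; apply: eq0_normc; apply/eqP.
rewrite eq_le normc_ge0 andbT; apply/ler_addgt0Pr => e e0; rewrite add0r.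
have [|v Kv vu] := Ku (e / (C + 1)); first by rewrite divr_gt0// ltr_wpDl.
have -> : F u = - F (v - u) by rewrite FB (FK v)// sub0r opprK.
rewrite normcN; apply: (le_trans (FC _)).
apply: (@le_trans _ _ ((C + 1) * N (v - u))).
  by rewrite ler_wpM2r ?Dp_banach_norm_ge0// lerDl.
by rewrite mulrC -ler_pdivlMr ?ltr_wpDl// ltW.
Qed.

Lemma Dp_fun_sum (J : Type) (r : seq J) (F : J -> D) g :
  (\sum_(i <- r) F i) g = \sum_(i <- r) F i g.
Proof. exact: (big_morph (fun v : D => v g) (id1 := 0) (op1 := +%R)). Qed.

Lemma Dp_sum_indicator u A : (forall g, g \notin A -> u g = 0) ->
  u = \sum_(g <- A) u g *: ind [fset g]%fset.
Proof.
move=> uA; apply/val_inj/funext => k.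
rewrite [RHS]Dp_fun_sum.
have kE g : (u g *: ind [fset g]%fset) k = u g * (k == g)%:R.
  by rewrite -[LHS]/(u g * (k \in [fset g]%fset)%:R) in_fset1.
under eq_bigr do rewrite kE.
have [kA|kA] := boolP (k \in A); last first.
  rewrite /= uA// big_seq big1// => g gA; case: eqVneq => [kg|]; last by rewrite mulr0.
  by rewrite kg gA in kA.
rewrite (bigD1_seq k kA (fset_uniq A))/= eqxx mulr1 big1 ?addr0// => g /negbTE gk.
by rewrite eq_sym gk mulr0.
Qed.

(** An increment along [s] is nonzero only where exactly one of [g] and [g * s^-1] is in [A], and
    then has modulus 1; so each generator contributes at most twice the size of [A]. *)
Lemma Dp_seminorm_indicator A :
  Dp_seminorm S p (ind A) `^ p <= 2 * #|` A|%:R * #|` generators S|%:R.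
Proof.
rewrite Dp_seminormE -lee_fin fineK; last exact: Dp_energy_fin (Dp_funP (ind A)).
rewrite Dp_energyE.
apply: (@le_trans _ _ (\sum_(s <- generators S) (2 * #|` A|%:R)%:E)%E).
  apply: lee_sum => s _.
  apply: (@le_trans _ _ (lpsum p (translate s (ind A)) + lpsum p (ind A))%E).
    rewrite -esumD; try by move=> g _; rewrite lee_fin powR_ge0.
    apply: le_esum => g _; rewrite -EFinD lee_fin /translate !fctE /=.
    case: (_ \in _); case: (_ \in _).
    - by rewrite subrr [normc 0]normc0 powR0// addr_ge0// powR_ge0.
    - by rewrite subr0 lerDl powR_ge0.
    - by rewrite sub0r normcN lerDr powR_ge0.
    - by rewrite subrr [normc 0]normc0 powR0// addr_ge0// powR_ge0.
  by rewrite lpsum_translate (lpsum_indicator p1) -EFinD mulr_natl mulr2n.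
rewrite sumEFin big_const_seq count_predT iter_addr_0 lee_fin.
by rewrite -(mulr_natr (2 * _)).
Qed.

(* An invariant functional takes one value [c] on all point masses, hence the
   value [n * c] on the indicator of an [n]-point set, whose norm is only
   [O(n ^ (1 / p))]; as [1 < p], [c] is [0]. *)
Lemma translation_invariant_finitely_supported T u :
  infinite_set [set: G] -> continuous T -> translation_invariant T ->
  fs u -> T (class u) = 0.
Proof.
move=> Ginf Tcont Tinv fu.
have [C C0 TC] := linear_continuous_bound Tcont.
pose c : R[i] := T (class (ind [fset 1%g]%fset)).
have cE g : T (class (ind [fset g]%fset)) = c.
  rewrite /c -(Tinv (class (ind [fset 1%g]%fset)) g) DpC_translate_class.
  congr (T (class _)); apply/val_inj/funext => k /=.
  rewrite !in_fset1 /translate; congr (_ %:R); congr nat_of_bool.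
  by rewrite in_fset1 -[RHS](inj_eq (mulIg g)) mulgVK mul1g.
have TE v A : (forall g, g \notin A -> v g = 0) -> T (class v) = (\sum_(g <- A) v g) * c.
  move=> vA; rewrite [in LHS](Dp_sum_indicator vA) DpC_class_sum linear_sum mulr_suml.
  by apply: eq_bigr => g _; rewrite DpC_classZ linearZ/= cE.
suff c0 : c = 0.
  have [A AE] := finite_fsetP.1 fu.
  rewrite (TE u A) ?c0 ?mulr0// => g gA; apply/eqP; apply: contraNT gA => ug.
  by have : [set` A] g by rewrite -AE.
apply: eq0_normc; apply/eqP; rewrite eq_le normc_ge0 andbT leNgt; apply/negP => cgt0.
have key A : (#|` A|%:R * normc c) `^ p <=
    C `^ p * (2 * #|` A|%:R * #|` generators S|%:R).
  have := TC (ind A); rewrite (TE (ind A) A); last by move=> g /negbTE /= ->.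
  rewrite big_seq (eq_bigr (fun => 1)); last by move=> g /= ->.
  rewrite -big_seq big_const_seq count_predT iter_addr_0 normcM.
  rewrite -[X in normc X * _](rmorph_nat (real_complex R)) normc_real normr_nat => h.
  apply: (@le_trans _ _ ((C * Dp_seminorm S p (ind A)) `^ p)).
    apply: ge0_ler_powR; rewrite ?nnegrE ?mulr_ge0 ?normc_ge0 ?(ltW C0) ?(ltW p0)//.
    exact: powR_ge0.
  rewrite powRM ?powR_ge0 ?(ltW C0)//.
  by rewrite ler_wpM2l ?powR_ge0// Dp_seminorm_indicator.
(* After division by the size of [A] and by the power of [normc c], [key] says that the size to the
   power [p - 1] is at most [B]; [n] is taken large enough to contradict this. *)
pose B : R := C `^ p * (2 * #|` generators S|%:R) / normc c `^ p.
have B0 : 0 <= B by rewrite divr_ge0 ?mulr_ge0 ?powR_ge0.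
have pm1 : 0 < p - 1 by rewrite subr_gt0.
pose n := (Num.truncn (B `^ (p - 1)^-1)).+1.
have [A _ nA] := infinite_set_fset n Ginf.
have A0 : 0 < #|` A|%:R :> R by rewrite ltr0n (leq_trans _ nA).
have := key A; rewrite powRM ?normc_ge0//.
rewrite (_ : C `^ p * _ = #|` A|%:R * B * normc c `^ p); last first.
  by rewrite /B; field; rewrite gt_eqF// powR_gt0.
rewrite ler_pM2r ?powR_gt0//.
have -> : (#|` A|%:R : R) `^ p = #|` A|%:R * #|` A|%:R `^ (p - 1).
  rewrite -[X in X * _]powRr1 ?ltW// -powRD; last by rewrite (gt_eqF A0) implybT.
  by rewrite addrC subrK.
rewrite ler_pM2l//; apply/negP; rewrite -ltNge.
have -> : B = (B `^ (p - 1)^-1) `^ (p - 1) by rewrite -powRrM mulVf ?powRr1// gt_eqF.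
apply: gt0_ltr_powR; rewrite ?nnegrE ?powR_ge0//.
apply: lt_le_trans (truncnS_gt _) _; rewrite ler_nat.
exact: nA.
Qed.

Lemma linear_exists (V : lmodType R[i]) (F : V -> R[i]^o) :
  (forall x y, F (x + y) = F x + F y) -> (forall c x, F (c *: x) = c *: F x) ->
  exists T : {linear V -> R[i]^o}, forall x, T x = F x.
Proof.
move=> FD FZ.
have Flin : linear F by move=> c x y; rewrite FD FZ.
pose Fl := GRing.isLinear.Build _ _ _ _ F Flin.
pose T : {linear V -> R[i]^o} := HB.pack F Fl.
by exists T.
Qed.

(** A point off the closure has positive distance to the finitely supported functions, so
    Hahn-Banach applies; boundedness carries the vanishing over to the closure. *)
Lemma separating_functional u : ~ closure fs u -> exists F : D -> R[i],
  [/\ scalar F, forall v, normc (F v) <= 2 * N v, forall v, closure fs v -> F v = 0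
    & F u != 0].
Proof.
move=> nu.
have [e e0 ue] : exists2 e : R, 0 < e & forall v, fs v -> e <= N (u - v).
  apply: contra_notP nu => nu; apply/closure_DpP => e e0.
  apply: contra_notP nu => nu; exists e; first exact: e0.
  move=> v fv; rewrite leNgt; apply/negP => uv; apply: nu.
  exists v; first exact: fv.
  by rewrite -Dp_banach_normN opprB.
have [|||||||F [Fs FN FL Fu]] := @hahn_banach R D N fs u e.
- exact: Dp_banach_normD.
- exact: Dp_banach_normZ.
- exact: finitely_supported0.
- exact: finitely_supportedD.
- exact: finitely_supportedZ.
- by [].
- by [].
exists F; split=> // v.
have FB x y : F (x - y) = F x - F y.
  by rewrite -scaleN1r addrC Fs mulN1r addrC.
exact: (@bounded_linear_closure F 2).
Qed.

End functionals.

(** * Two boundary characters versus an invariant functional *)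

Lemma card_ge2P (T : Type) (A : set T) :
  (`I_2 #<= A)%card <-> exists a b, [/\ A a, A b & a <> b].
Proof.
split=> [/card_leP[f]|[a [b [Aa Ab ab]]]].
  pose x0 : `I_2 := SigSub (mem_set (isT : `I_2 0%N)).
  pose x1 : `I_2 := SigSub (mem_set (isT : `I_2 1%N)).
  exists (val (f x0)), (val (f x1)); split; try exact: set_valP.
  by move=> /val_inj/(inj (in_setT _) (in_setT _))/(congr1 val).
pose f (n : nat) := if n == 0%N then a else b.
have finj : {in `I_2 &, injective f}.
  by move=> [|[|i]] [|[|j]]; rewrite !inE//= /f/= => _ _ // /esym.
apply: (@card_le_trans _ _ _ (f @` `I_2)).
  by have := inj_card_eq finj; rewrite card_eq_le => /andP[].
by apply: subset_card_le => _ [n _ <-]; rewrite /f; case: ifP.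
Qed.

Theorem theorem2p5 (R : realType) (G : groupType) (S : generating_set G)
    (p : R) (p1 : 1 < p) :
  infinite_set [set: G] ->
  ((`I_2 #<= p_harmonic_boundary S p1)%card <->
   exists T : {linear DpC S p1 -> R[i]^o},
     [/\ exists q, T q != 0, continuous T & translation_invariant T]).
Proof.
move=> Ginf; split.
  move=> /card_ge2P[sigma [tau [f0 f1 st]]].
  have [u fu] : exists u, sigma u != tau u.
    apply: contrapT => fE; apply: st; apply/funext => u.
    by apply: contrapT => /eqP fu; apply: fE; exists u.
  (* A boundary character is unital and kills the ideal, so its value at [u] is [c] as soon as
     [u - c] is in the ideal. As [sigma u] and [tau u] differ, there is no such [c]. *)
  have charE rho : p_harmonic_boundary S p1 rho ->
      (forall c : R[i], B_closure S p1 (u - c *: (1 : BDp S p1)) -> rho u = c) /\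
      ~ B_closure S p1 (1 : BDp S p1).
    move=> [[[tauL tauM [v v0]] _] tau0].
    have tau1 : rho 1 = 1.
      by apply: (mulfI v0); rewrite -tauM !mulr1.
    split; last by move=> /tau0/eqP; rewrite tau1 oner_eq0.
    move=> c /tau0; rewrite -scaleNr addrC tauL tau1 mulr1 addrC => /eqP.
    by rewrite subr_eq0 => /eqP.
  have [_ n1] := charE _ f0.
  have [T1 [T1s T1N T1fs T11]] := separating_functional n1.
  pose one : Dp S p1 := BDp_inclusion 1.
  (* This [c] makes the value of [F] at [u] equal to that of [T2] at [u - c], which is nonzero. *)
  pose c := T1 (BDp_inclusion u) / T1 one.
  have nu : ~ closure (finitely_supported S p1) (BDp_inclusion (u - c *: (1 : BDp S p1))).
    by move=> h; move/eqP: fu; apply; rewrite ((charE _ f0).1 c h) ((charE _ f1).1 c h).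
  have [T2 [T2s T2N T2fs T2u]] := separating_functional nu.
  (* The multiple of [T1] cancels the value of [T2] at [one], so that [F] descends to the quotient
     by constants. *)
  pose F v : R[i] := T2 v - (T2 one / T1 one) * T1 v.
  have FD v w : F (v + w) = F v + F w.
    by rewrite /F -[v]scale1r T1s T2s !mul1r scale1r; ring.
  have T0 (T : Dp S p1 -> R[i]) : scalar T -> T 0 = 0.
    by move=> Ts; have := Ts (-1) 0 0; rewrite scaler0 addr0 mulN1r addNr.
  have FZ a v : F (a *: v) = a * F v.
    by rewrite /F -[a *: v]addr0 T1s T2s !T0// !addr0; ring.
  have F1 : F one = 0 by rewrite /F divfK// subrr.
  have Fu : F (BDp_inclusion u) != 0.
    suff -> : F (BDp_inclusion u) = T2 (BDp_inclusion (u - c *: (1 : BDp S p1))) by [].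
    have -> : BDp_inclusion (u - c *: (1 : BDp S p1)) = (- c) *: one + BDp_inclusion u.
      by apply/val_inj/funext => g; rewrite addrC -scaleNr.
    by rewrite T2s /F /c; field.
  have Fcst (v w : Dp S p1) (a : R[i]) : (forall g, v g = w g + a) -> F v = F w.
    move=> vw; have -> : v = a *: one + w.
      apply/val_inj/funext => g; rewrite /= vw addrC; congr (_ + _).
      by rewrite -[RHS]/(a * 1) mulr1.
    by rewrite FD FZ F1 mulr0 add0r.
  pose C : R := 2 + normc (T2 one / T1 one) * 2.
  have C0 : 0 <= C by rewrite addr_ge0// mulr_ge0// normc_ge0.
  have FN v : normc (F v) <= C * Dp_banach_norm S p v.
    apply: le_trans (normcD _ _) _; rewrite normcN normcM mulrDl.
    by apply: lerD => //; rewrite -mulrA ler_wpM2l ?normc_ge0.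
  (* Subtracting the constant [v 1%g] removes the second term of the Banach norm and turns it into
     the seminorm. *)
  have FS v : normc (F v) <= C * Dp_seminorm S p v.
    pose w : Dp S p1 := (- v 1%g) *: one + v.
    have wE (g : G) : w g = v g - v 1%g.
      by rewrite -[LHS]/(- v 1%g * 1 + v g) mulr1 addrC.
    rewrite -(Fcst w v (- v 1%g))//; apply: le_trans (FN w) _.
    rewrite ler_wpM2l// /Dp_banach_norm wE subrr [normc _]normc0 powR0 ?addr0; last first.
      by rewrite gt_eqF// (lt_trans ltr01).
    rewrite (root_powR p1 (Dp_seminorm_ge0 _ _)) le_eqVlt; apply/orP; left.
    by apply/eqP; exact: (Dp_seminorm_cst wE).
  have Frepr v : F (repr (DpC_class v)) = F v.
    by have [a va] := repr_DpC v; exact: Fcst va.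
  have [||T TE] := @linear_exists _ (DpC S p1) (fun q => F (repr q)).
  - move=> q r; rewrite -(DpC_reprK q) -(DpC_reprK r) -DpC_classD !Frepr.
    exact: FD.
  - move=> a q; rewrite -(DpC_reprK q) -DpC_classZ !Frepr.
    exact: FZ.
  exists T; split.
  - by exists (DpC_class (BDp_inclusion u)); rewrite TE Frepr.
  - apply/linear_bounded_continuous/linear_boundedP.
    apply: filterS (nbhs_pinfty_ge (_ : C%:C \is Num.real)); last first.
      by rewrite realE lecR C0.
    move=> r Cr q; apply: (@le_trans _ _ (C%:C * `|q|)); last exact: ler_wpM2r.
    rewrite TE; change (`|F (repr q)| <= C%:C * (DpC_norm q)%:C).
    have := FS (repr q); rewrite -lecR rmorphM; exact.
  - move=> q g; rewrite -(DpC_reprK q) DpC_translate_class !TE !Frepr.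
    set v := repr q; apply/eqP; rewrite -subr_eq0.
    have -> : F (Dp_translate g v) - F v = F (Dp_translate g v - v).
      by rewrite -[- v]scaleN1r FD FZ mulN1r.
    have cl : closure (finitely_supported S p1) (Dp_translate g v - v).
      apply: lpsum_closure_fs; exact: in_Dp_diff (Dp_funP v).
    by rewrite /F (T1fs _ cl) (T2fs _ cl) mulr0 subrr.
move=> [T [[q Tq] Tcont Tinv]].
have [C C0 TC] := linear_continuous_bound Tcont.
have TN v : normc (T (DpC_class v) : R[i]) <= C * Dp_banach_norm S p v.
  by apply: le_trans (TC v) _; rewrite ler_wpM2l ?(ltW C0)// Dp_seminorm_le.
have TB (v w : Dp S p1) : T (DpC_class (v - w)) = T (DpC_class v) - T (DpC_class w).
  by rewrite /DpC_class !raddfB.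
have Tfs v : closure (finitely_supported S p1) v -> T (DpC_class v) = 0.
  apply: (bounded_linear_closure (ltW C0) TB TN) => w fw.
  exact: translation_invariant_finitely_supported.
(* Bounded functions are dense, so [T] cannot vanish on all their classes. *)
have [u Tu] : exists u : BDp S p1, T (DpC_class (BDp_inclusion u)) != 0.
  apply: contrapT => Tb; move/eqP: Tq; apply; rewrite -(DpC_reprK q).
  apply: (bounded_linear_closure (ltW C0) TB TN _ (@closure_bounded _ _ _ S p1 (repr q))).
  move=> w wb; apply: contrapT => /eqP Tw; apply: Tb.
  exists (mkBDp p1 (conj (Dp_funP w) wb)).
  by rewrite (_ : BDp_inclusion _ = w)//; exact: val_inj.
have nu (c : R[i]) : ~ B_closure S p1 (u - c *: (1 : BDp S p1)).
  move=> /Tfs; rewrite (_ : DpC_class _ = DpC_class (BDp_inclusion u)); first exact/eqP.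
  apply/DpC_classE; exists (- c) => g.
  by rewrite -[LHS]/(u g - c * 1) mulr1.
have [tau1 tau1b tau1u] := boundary_point (nu 0).
(* The second character does not vanish at [u - tau1 u], so it differs from [tau1] at [u]. *)
have [tau2 tau2b tau2u] := boundary_point (nu (tau1 u)).
apply/card_ge2P; exists tau1, tau2; split=> // tauE; move/eqP: tau2u; apply.
have [[[tauL tauM [v v0]] _] _] := tau2b.
have tau21 : tau2 1 = 1 by apply: (mulfI v0); rewrite -tauM !mulr1.
by rewrite -scaleNr addrC tauL tau21 mulr1 tauE addNr.
Qed.
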